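(* Let $\dim(\mathcal{X})<\infty$. Suppose that at least one of the following holds: (i) $\mathcal{X}$ is smooth; (ii) $\mathcal{X}^*$ is smooth; (iii) $\mathcal{X}$ is polyhedral; (iv) $\dim(\mathcal{X})=2$. Then $E_{\mathcal{Z}^*}=\mathcal{U}_d$, where $$\mathcal{U}_d=\{(\alpha_1x^*\otimes x,\ldots,\alpha_dx^*\otimes x):(\alpha_1,\ldots,\alpha_d)\in S_{\ell_q^d},\ x^*\in E_{\mathcal{X}^*},\ x\in E_{\mathcal{X}},\ x^*(x)=1\}.$$
   Context: $\mathcal{X}$ is a nonzero Banach space over $\mathbb{F}$ ($\mathbb{R}$ or $\mathbb{C}$) with dual $\mathcal{X}^*$. For a normed space $\mathcal{Y}$, $B_{\mathcal{Y}}$ is its closed unit ball, $S_{\mathcal{Y}}$ its unit sphere, and $E_{\mathcal{Y}}$ the set of extreme points of $B_{\mathcal{Y}}$. A nonzero vector $y\in\mathcal{Y}$ is smooth if $\{f\in\mathcal{Y}^*:\|f\|=1, f(y)=\|y\|\}$ is a singleton, and the space $\mathcal{Y}$ is smooth if all its nonzero vectors are smooth. A finite-dimensional Banach space is polyhedral if its unit ball has finitely many extreme points. $\mathcal{L}(\mathcal{X})$ is the space of bounded linear operators on $\mathcal{X}$; $\Pi=\{(x,x^* ): x\in S_{\mathcal{X}},\ x^*\in S_{\mathcal{X}^*},\ x^*(x)=1\}$. Standing assumption: the numerical radius $w(T)=\sup\{|x^*(Tx)|:(x,x^* )\in\Pi\}$ is a norm on $\mathcal{L}(\mathcal{X})$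 (automatic if $\mathbb{F}=\mathbb{C}$). Fix an integer $d\ge 1$ and $1<p<\infty$, and let $\frac1p+\frac1q=1$. The joint numerical radius of $\mathcal{T}=(T_1,\ldots,T_d)\in\mathcal{L}(\mathcal{X})^d$ is $w_p(\mathcal{T})=\sup\{(\sum_{i=1}^d|x^*(T_ix)|^p)^{1/p}:(x,x^* )\in\Pi\}$, and $\mathcal{Z}=(\mathcal{L}(\mathcal{X})^d,w_p(\cdot))$, with dual $\mathcal{Z}^*$ carrying the dual norm. $\ell_q^d$ is $\mathbb{F}^d$ with the $q$-norm. For $\alpha_i\in\mathbb{F}$, $x\in\mathcal{X}$, $x^*\in\mathcal{X}^*$, $(\alpha_1x^*\otimes x,\ldots,\alpha_dx^*\otimes x)$ denotes the linear functional $(T_1,\ldots,T_d)\mapsto\sum_{i=1}^d\alpha_i x^*(T_ix)$ on $\mathcal{L}(\mathcal{X})^d$. *)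

(* Defs.v *)
From HB Require Import structures.
From mathcomp Require Import all_boot all_order all_algebra.
From mathcomp Require Import complex.
From mathcomp Require Import all_classical all_reals all_analysis.

Set Implicit Arguments.
Unset Strict Implicit.
Unset Printing Implicit Defensive.

Import Order.TTheory GRing.Theory Num.Theory.
Import numFieldNormedType.Exports.

Local Open Scope classical_set_scope.
Local Open Scope ring_scope.

Inductive scalars := RealScalars | ComplexScalars.

Definition scalarField (R : realType) (s : scalars) : numFieldType :=
  match s with
  | RealScalars => R
  | ComplexScalars => R[i]
  end.

Definition ofReal (R : realType) (s : scalars) : R -> scalarField R s :=
  match s with
  | RealScalars => fun x => x
  | ComplexScalars => fun x => (x%:C)%C
  end.
Arguments ofReal {R s}.

Definition toReal (R : realType) (s : scalars) : scalarField R s -> R :=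
  match s with
  | RealScalars => fun x => x
  | ComplexScalars => fun z => complex.Re z
  end.
Arguments toReal {R s}.

(* In a [normedModType K] the norm takes its values in K, also for K = R[i];
   [rnorm x] is this norm as an element of R. *)
Definition rnorm (R : realType) (s : scalars)
  (W : normedModType (scalarField R s)) (x : W) : R := toReal `|x|.

Definition modulus (R : realType) (s : scalars) (z : scalarField R s) : R :=
  rnorm (z : (scalarField R s)^o).

Lemma toRealD (R : realType) (s : scalars) (x y : scalarField R s) :
  toReal (x + y) = toReal x + toReal y.
Proof. by case: s x y => //= -[a b] [c e]. Qed.

Lemma toReal_le (R : realType) (s : scalars) (x y : scalarField R s) :
  x <= y -> toReal x <= toReal y.
Proof. by case: s x y => //= -[a b] [c e]; rewrite lecE => /andP[]. Qed.

Lemma toRealM_ge0 (R : realType) (s : scalars) (x y : scalarField R s) :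
  0 <= x -> toReal (x * y) = toReal x * toReal y.
Proof.
case: s x y => //= -[a b] [c e]; rewrite lecE /= => /andP[/eqP b0 _].
by rewrite b0 mul0r subr0.
Qed.

Lemma rnorm0 (R : realType) (s : scalars)
  (W : normedModType (scalarField R s)) : rnorm (0 : W) = 0.
Proof. by rewrite /rnorm normr0; case: s W. Qed.

Lemma rnormD (R : realType) (s : scalars)
  (W : normedModType (scalarField R s)) (x y : W) :
  rnorm (x + y) <= rnorm x + rnorm y.
Proof. by rewrite /rnorm -toRealD; apply/toReal_le/ler_normD. Qed.

Lemma rnormZ (R : realType) (s : scalars)
  (W : normedModType (scalarField R s)) (a : scalarField R s) (x : W) :
  rnorm (a *: x) = modulus a * rnorm x.
Proof. by rewrite /modulus /rnorm normrZ toRealM_ge0. Qed.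

Lemma modulus_ge0 (R : realType) (s : scalars) (a : scalarField R s) :
  0 <= modulus a.
Proof. by have := @toReal_le R s _ _ (normr_ge0 a); case: s a. Qed.

(* From here on a normed space is given by an [lmodType] together with a
   function [N] to R; the norm [rnorm] of a [normedModType], operator norms
   and numerical radii are all used in this role. *)

Definition is_norm (R : realType) (s : scalars)
  (V : lmodType (scalarField R s)) (N : V -> R) : Prop :=
  [/\ forall v, N v = 0 -> v = 0,
      forall a v, N (a *: v) = modulus a * N v
    & forall u v, N (u + v) <= N u + N v].

Definition unit_ball (R : realType) (s : scalars)
  (V : lmodType (scalarField R s)) (N : V -> R) : set V :=
  [set v | N v <= 1].

Definition unit_sphere (R : realType) (s : scalars)
  (V : lmodType (scalarField R s)) (N : V -> R) : set V :=
  [set v | N v = 1].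

Definition bounded_linear (R : realType) (s : scalars)
  (V : lmodType (scalarField R s)) (N : V -> R)
  (W : normedModType (scalarField R s)) (f : V -> W) : Prop :=
  linear f /\ exists C : R, forall v, rnorm (f v) <= C * N v.

Definition bounded_linear_pred (R : realType) (s : scalars)
  (V : lmodType (scalarField R s)) (N : V -> R)
  (W : normedModType (scalarField R s)) : {pred V -> W} :=
  fun f => `[< bounded_linear N f >].

Lemma bounded_linear_submod (R : realType) (s : scalars)
  (V : lmodType (scalarField R s)) (N : V -> R)
  (W : normedModType (scalarField R s)) :
  submod_closed (@bounded_linear_pred R s V N W).
Proof.
split.
  apply/asboolP; split; first by move=> a u v /=; rewrite scaler0 addr0.
  by exists 0 => v; rewrite rnorm0 mul0r.
move=> a f g /asboolP[lf [C Cf]] /asboolP[lg [D Dg]]; apply/asboolP; split.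
  move=> b u v.
  rewrite -[LHS]/(a *: f (b *: u + v) + g (b *: u + v)).
  rewrite -[RHS]/(b *: (a *: f u + g u) + (a *: f v + g v)) lf lg.
  by rewrite !scalerDr !scalerA [b * a]mulrC addrACA.
exists (modulus a * C + D) => v; rewrite mulrDl.
apply: (le_trans (rnormD _ _)); apply: lerD => //.
by rewrite rnormZ -mulrA ler_wpM2l ?modulus_ge0.
Qed.

HB.instance Definition _ (R : realType) (s : scalars)
  (V : lmodType (scalarField R s)) (N : V -> R)
  (W : normedModType (scalarField R s)) :=
  GRing.isSubmodClosed.Build _ _ (@bounded_linear_pred R s V N W)
    (@bounded_linear_submod R s V N W).

Record bounded_op (R : realType) (s : scalars)
  (V : lmodType (scalarField R s)) (N : V -> R)
  (W : normedModType (scalarField R s)) := BoundedOp {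
  bounded_fun :> V -> W;
  _ : bounded_fun \in @bounded_linear_pred R s V N W
}.

Section BoundedOpLmodule.
Context (R : realType) (s : scalars) (V : lmodType (scalarField R s))
  (N : V -> R) (W : normedModType (scalarField R s)).
HB.instance Definition _ := [isSub for @bounded_fun R s V N W].
HB.instance Definition _ := [Choice of bounded_op N W by <:].
HB.instance Definition _ :=
  [SubChoice_isSubLmodule of bounded_op N W by <:].
End BoundedOpLmodule.

Definition opnorm (R : realType) (s : scalars)
  (V : lmodType (scalarField R s)) (N : V -> R)
  (W : normedModType (scalarField R s)) (f : bounded_op N W) : R :=
  sup [set rnorm (f v) | v in unit_ball N].

Definition dual (R : realType) (s : scalars)
  (V : lmodType (scalarField R s)) (N : V -> R) :
    lmodType (scalarField R s) :=
  bounded_op N (scalarField R s)^o.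

Definition dual_norm (R : realType) (s : scalars)
  (V : lmodType (scalarField R s)) (N : V -> R) : dual N -> R :=
  @opnorm R s V N (scalarField R s)^o.
Arguments dual_norm {R s V} N f.

Definition dual_fun (R : realType) (s : scalars)
  (V : lmodType (scalarField R s)) (N : V -> R) (f : dual N) :
    V -> scalarField R s :=
  @bounded_fun R s V N (scalarField R s)^o f.

Definition extreme_points (R : realType) (s : scalars)
  (V : lmodType (scalarField R s)) (A : set V) : set V :=
  [set v | A v /\ forall (u w : V) (t : R), A u -> A w -> 0 < t < 1 ->
     v = ofReal t *: u + ofReal (1 - t) *: w -> u = v /\ w = v].

Definition ball_extreme_points (R : realType) (s : scalars)
  (V : lmodType (scalarField R s)) (N : V -> R) : set V :=
  extreme_points (unit_ball N).

Definition smooth_vector (R : realType) (s : scalars)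
  (V : lmodType (scalarField R s)) (N : V -> R) (y : V) : Prop :=
  exists f : dual N,
    [set g : dual N | dual_norm N g = 1 /\ dual_fun g y = ofReal (N y)]
    = [set f].

Definition smooth_space (R : realType) (s : scalars)
  (V : lmodType (scalarField R s)) (N : V -> R) : Prop :=
  forall y : V, y != 0 -> smooth_vector N y.

(* The same data as in [Vector.axiom], as a proposition. *)
Definition has_dim (K : fieldType) (V : lmodType K) (n : nat) : Prop :=
  exists2 v2r : V -> 'rV[K]_n, linear v2r & bijective v2r.

Definition finite_dim (K : fieldType) (V : lmodType K) : Prop :=
  exists n, has_dim V n.

Definition polyhedral (R : realType) (s : scalars)
  (V : lmodType (scalarField R s)) (N : V -> R) : Prop :=
  finite_dim V /\ finite_set (ball_extreme_points N).

Definition lp_norm (R : realType) (s : scalars) (d : nat) (p : R)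
  (a : 'I_d -> scalarField R s) : R :=
  (\sum_(i < d) modulus (a i) `^ p) `^ p^-1.

Section JointNumericalRadius.
Context (R : realType) (s : scalars)
  (X : completeNormedModType (scalarField R s)).

Definition Xnorm : X -> R := fun x => rnorm x.

Definition Xdual : lmodType (scalarField R s) := dual Xnorm.

Definition operators : lmodType (scalarField R s) := bounded_op Xnorm X.

Definition op_fun (T : operators) : X -> X :=
  @bounded_fun R s X Xnorm X T.

Definition state_pairs : set (X * Xdual) :=
  [set u | [/\ unit_sphere Xnorm u.1,
               unit_sphere (dual_norm Xnorm) u.2
             & dual_fun u.2 u.1 = 1]].

Definition num_radius (T : operators) : R :=
  sup [set modulus (dual_fun u.2 (op_fun T u.1)) | u in state_pairs].

Definition operator_tuples (d : nat) : lmodType (scalarField R s) :=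
  {ffun 'I_d -> operators}.

Definition tuple_nth (d : nat) (T : operator_tuples d) (i : 'I_d) :
  operators := (T : {ffun 'I_d -> operators}) i.

Definition joint_num_radius (d : nat) (p : R) (T : operator_tuples d) : R :=
  sup [set lp_norm p (fun i => dual_fun u.2 (op_fun (tuple_nth T i) u.1))
      | u in state_pairs].

Definition tensor_functional (d : nat) (a : 'I_d -> scalarField R s)
  (f : Xdual) (x : X) : operator_tuples d -> scalarField R s :=
  fun T => \sum_(i < d) a i * dual_fun f (op_fun (tuple_nth T i) x).

Definition Zdual (d : nat) (p : R) : lmodType (scalarField R s) :=
  dual (@joint_num_radius d p).

Definition Zdual_norm (d : nat) (p : R) : Zdual d p -> R :=
  dual_norm (@joint_num_radius d p).

Definition Zdual_fun (d : nat) (p : R) (phi : Zdual d p) :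
    operator_tuples d -> scalarField R s :=
  dual_fun phi.

(* These are bare functions on L(X)^d, so an inclusion of [U_set] in the
   functionals of [Zdual] also says that they are bounded for w_p. *)
Definition U_set (d : nat) (q : R) :
    set (operator_tuples d -> scalarField R s) :=
  [set phi | exists (a : 'I_d -> scalarField R s) (f : Xdual) (x : X),
     [/\ lp_norm q a = 1,
         ball_extreme_points (dual_norm Xnorm) f,
         ball_extreme_points Xnorm x,
         dual_fun f x = 1
       & phi = tensor_functional a f x]].

End JointNumericalRadius.

Arguments Xnorm {R s} X x.
Arguments state_pairs {R s} X.
Arguments num_radius {R s} X T.
Arguments joint_num_radius {R s} X d p T.
Arguments Zdual {R s} X d p.
Arguments Zdual_norm {R s} X d p phi.
Arguments U_set {R s} X d q.

(* Main.v *)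
Require Import Defs.
From HB Require Import structures.
From mathcomp Require Import all_boot all_order all_algebra.
From mathcomp Require Import complex.
From mathcomp Require Import all_classical all_reals all_analysis.
From mathcomp Require Import ring lra.

(** Write a (x) f (x) x for the functional sending (T_1, ..., T_d) to
    sum_i a_i f(T_i x), and K for the set of those with |a|_q <= 1 and (x, f) in
    Pi.  By Hoelder's inequality K lies in the unit ball B of the dual of Z, and
    because every vector of l_p has a norming vector in the ball of l_q, w_p(T)
    is the supremum of Re k(T) over k in K.  The space is finite-dimensional,
    so K is compact; its convex hull is compact by Caratheodory's theorem, and
    separating a point from it shows that B is exactly the convex hull of K
    ([Zdual_ball_hull]).

    An extreme point of B is therefore some a (x) f (x) x in K
    ([extreme_is_tensor]).  It has |a|_q = 1, since otherwise a would lie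
    strictly between two points c and - c of the ball.  If x = t u + (1 - t) v
    in the ball of X, then f(u) = f(v) = 1, so a (x) f (x) x splits into two
    elements of K; extremality makes them equal, and testing on rank-one
    operators gives u = v = x.  The same argument applies to f.

    Conversely ([tensor_extreme]) let a, f and x be extreme with f(x) = 1.
    If a (x) f (x) x is the middle of a segment in B, both ends are convex
    combinations of K, so it suffices to show that in any equality
    a (x) f (x) x = sum_j w_j a_j (x) f_j (x) x_j with elements of K each term
    with w_j > 0 equals the left-hand side ([extreme_tensor_combination]).
    Evaluating at multiples of the identity gives a = sum_j w_j a_j, and the
    equality case of Young's inequality gives a_j = a.  There remains
    f(S x) = sum_j w_j f_j(S x_j) for all operators S.  Taking S of rank one
    with range spanned by x yields x = sum_j w_j f_j(x) x_j, hence
    f_j(x) x_j = x because x is extreme; taking S y = f(y) u yields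
    f = sum_j w_j f(x_j) f_j, hence f(x_j) f_j = f.  As
    f_j(x) f(x_j) = f(x) = 1, the scalars cancel and f_j(S x_j) = f(S x) for
    every S. *)

Set Implicit Arguments.
Unset Strict Implicit.
Unset Printing Implicit Defensive.

Import Order.TTheory GRing.Theory Num.Theory.
Import numFieldNormedType.Exports.

Local Open Scope classical_set_scope.
Local Open Scope ring_scope.

(** * Continuity and compactness in coordinates *)

Lemma continuous_sum (R : realType) (T : topologicalType) (I : finType)
  (f : I -> T -> R) :
  (forall i, continuous (f i)) -> continuous (fun t => \sum_i f i t).
Proof.
move=> fc; elim: (index_enum I) => [|i r IH] t.
  by under eq_fun do rewrite big_nil; exact: cvg_cst.
by under eq_fun do rewrite big_cons; apply: cvgD; [exact: fc|exact: IH].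
Qed.

Lemma continuous_mulr (R : realType) (T : topologicalType)
  (f g : T -> R) :
  continuous f -> continuous g ->
  continuous (fun t => f t * g t).
Proof. by move=> fc gc t; apply: cvgM; [exact: fc|exact: gc]. Qed.

Lemma continuous_addr (R : realType) (T : topologicalType)
  (f g : T -> R) :
  continuous f -> continuous g ->
  continuous (fun t => f t + g t).
Proof. by move=> fc gc t; apply: cvgD; [exact: fc|exact: gc]. Qed.

Lemma continuous_subr (R : realType) (T : topologicalType)
  (f g : T -> R) :
  continuous f -> continuous g ->
  continuous (fun t => f t - g t).
Proof. by move=> fc gc t; apply: cvgB; [exact: fc|exact: gc]. Qed.

Lemma continuous_rowP (R : realType) (T : topologicalType) (n : nat)
  (f : T -> 'rV[R]_n) :
  (forall j, continuous (fun t => f t 0 j)) -> continuous f.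
Proof.
move=> fc t A [P fP PA].
have : \forall u \near t, forall j, P 0 j (f u 0 j).
  apply: filter_forall => j; apply: (fc j t); exact: fP.
by apply: filterS => u Pu; apply: PA => i j; rewrite ord1; exact: Pu.
Qed.

Lemma continuous_entry (T : topologicalType) (m n : nat) i j :
  continuous (fun M : 'M[T]_(m, n) => M i j).
Proof.
move=> M A MA; exists (fun i' j' => if (i' == i) && (j' == j) then A else setT).
  move=> i' j'; case: ifPn => [/andP[/eqP-> /eqP->]//|_]; exact: filterT.
by move=> N /(_ i j); rewrite !eqxx.
Qed.

Lemma compact_cube (R : realType) (k : nat) (C D : R) :
  compact [set w : 'rV[R]_k | forall i, `[C, D]%classic (w ord0 i)].
Proof.
have := @rV_compact R k (fun=> [set` `[C, D]]).
by apply=> _; exact: segment_compact.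
Qed.

Lemma closed_sublevel (R : realType) (T : topologicalType) (g : T -> R)
  (c : R) : continuous g -> closed [set t | g t <= c].
Proof.
move=> gc; apply: (@preimage_closed _ _ g [set x | x <= c]).
  by move=> t _; exact: gc.
exact: closed_le.
Qed.

Lemma closed_forall_le (R : realType) (T : topologicalType) (I : Type)
  (g : I -> T -> R) (h : I -> R) : (forall i, continuous (g i)) ->
  closed [set t | forall i, g i t <= h i].
Proof.
move=> gc t clt i.
have cl := closed_sublevel (c := h i) (gc i).
by apply: cl => A /clt[u [uP Au]]; exists u; split => //; exact: uP.
Qed.

(** * Convex hulls of compact sets in R^N *)

Definition convex_hull_upto (R : realType) (V : lmodType R) (K : set V)
  (m : nat) : set V :=
  [set v | exists (w : 'I_m -> R) (x : 'I_m -> V),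
     [/\ forall i, 0 <= w i, \sum_i w i = 1, forall i, K (x i)
       & v = \sum_i w i *: x i]].

Lemma affine_dependence (R : realType) (N m : nat) (x : 'I_m -> 'rV[R]_N) :
  (N.+1 < m)%N ->
  exists2 u : 'I_m -> R, exists i, 0 < u i
    & \sum_i u i = 0 /\ \sum_i u i *: x i = 0.
Proof.
move=> Nm; pose A : 'M[R]_(m, 1 + N) := \matrix_i row_mx (1%:M : 'M[R]_1) (x i).
(* The rows (1, x i) are more than the number of columns, hence dependent. *)
have /rowV0Pn[u /sub_kermxP uA u0] : kermx A != 0.
  by rewrite kermx_eq0 /row_free neq_ltn (leq_ltn_trans (rank_leq_col A)).
have uAE k : \sum_i u 0 i * A i k = 0.
    by have := congr1 (fun M : 'rV[R]_(1 + N) => M 0 k) uA; rewrite !mxE.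
have Su : \sum_i u 0 i = 0.
  rewrite -[RHS](uAE (lshift N 0)); apply: eq_bigr => i _.
  by rewrite mxE row_mxEl mxE eqxx mulr1.
have Sx : \sum_i u 0 i *: x i = 0.
  apply/rowP => j; rewrite summxE [RHS]mxE -[RHS](uAE (rshift 1 j)).
  by apply: eq_bigr => i _; rewrite mxE [A _ _]mxE row_mxEr.
(* The u i sum to 0 and are not all 0, so they cannot all be nonpositive. *)
exists (u 0) => //; apply/not_existsP => un.
have uN i : 0 <= - u 0 i by rewrite oppr_ge0 leNgt; apply/negP/un.
have uNS : \sum_i (- u 0 i) = 0 by rewrite sumrN Su oppr0.
move/negP: u0; apply; apply/eqP/rowP => i; rewrite mxE.
have /eqP := @psumr_eq0P _ _ xpredT _ (fun i _ => uN i) uNS i isT.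
by rewrite oppr_eq0 => /eqP.
Qed.

Lemma caratheodory_step (R : realType) (N m : nat) (K : set 'rV[R]_N) :
  (N < m)%N ->
  convex_hull_upto K m.+1 `<=` convex_hull_upto K m.
Proof.
move=> Nm v [w [x [w0 w1 xK ->]]].
have [u [i1 ui1] [Su Sx]] := @affine_dependence R N m.+1 x Nm.
have := @Order.TotalTheory.arg_minP _ _ _ i1 (fun i => 0 < u i)
  (fun i => w i / u i) ui1.
set i0 := (X in extremum_spec _ _ _ X) => -[]//; move=> i u_gt0 imin.
(* Subtracting t u with this least ratio t keeps the weights nonnegative
   and makes that of x i vanish. *)
pose t := w i / u i.
have t0 : 0 <= t by rewrite divr_ge0// ltW.
pose w' j := w j - t * u j.
have w'i : w' i = 0 by rewrite /w' /t divfK ?subrr// gt_eqF.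
have w'0 j : 0 <= w' j.
  rewrite subr_ge0; have [uj|uj] := ltP 0 (u j).
    by rewrite -ler_pdivlMr// imin.
  by rewrite (le_trans _ (w0 j))// mulr_ge0_le0.
have w'1 : \sum_j w' j = 1.
  by rewrite sumrB -mulr_sumr Su mulr0 subr0.
have w'x : \sum_j w' j *: x j = \sum_j w j *: x j.
  under eq_bigr do rewrite scalerBl -scalerA.
  by rewrite sumrB -scaler_sumr Sx scaler0 subr0.
exists (w' \o lift i), (x \o lift i); split => //=.
- by move: w'1; rewrite (bigD1_ord i)//= w'i add0r.
- by rewrite -w'x (bigD1_ord i)//= w'i scale0r add0r.
Qed.

Lemma caratheodory (R : realType) (N m : nat) (K : set 'rV[R]_N) :
  K !=set0 ->
  convex_hull_upto K m `<=` convex_hull_upto K N.+1.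
Proof.
move=> [k0 Kk0]; have [mN|] := leqP m N.+1.
  (* Pad with copies of k0 of weight 0. *)
  rewrite -(subnKC mN) => v [w [x [w0 w1 xK ->]]].
  exists (fun i : 'I_(m + (N.+1 - m)) =>
      match fintype.split i with inl j => w j | inr _ => 0 end),
    (fun i : 'I_(m + (N.+1 - m)) =>
      match fintype.split i with inl j => x j | inr _ => k0 end); split.
  - by move=> i; case: fintype.split.
  - rewrite big_split_ord/= [X in _ + X]big1 ?addr0; last first.
      by move=> i _; rewrite (unsplitK (inr i)).
    by rewrite -w1; apply: eq_bigr => i _; rewrite (unsplitK (inl i)).
  - by move=> i; case: fintype.split.
  - rewrite big_split_ord/= [X in _ = _ + X]big1 ?addr0; last first.
      by move=> i _; rewrite (unsplitK (inr i)) scale0r.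
    by apply: eq_bigr => i _; rewrite (unsplitK (inl i)).
elim: m => // m IH Nm v vm1.
have {vm1}vm := @caratheodory_step R N m K Nm v vm1.
move: Nm; rewrite ltnS leq_eqVlt => /predU1P[mE|/IH]; last exact.
by move: vm; rewrite -mE.
Qed.

(** The combinations of m points of K are the image of the product of a simplex
    with m copies of K. *)
Lemma compact_convex_hull_upto (R : realType) (N m : nat) (K : set 'rV[R]_N) :
  compact K -> compact (convex_hull_upto K m).
Proof.
move=> cK.
pose W := [set w : 'rV[R]_m | forall i, `[0, 1]%classic (w ord0 i)].
have cW : compact W by exact: compact_cube.
pose W1 := W `&` [set w : 'rV[R]_m | \sum_i w 0 i = 1].
have cW1 : compact W1.
  apply: compact_closedI => //.
  apply: (@preimage_closed _ _ (fun w : 'rV[R]_m => \sum_i w 0 i) [set 1]).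
    by move=> w _; apply: continuous_sum => i; exact: coord_continuous.
  exact: closed_eq.
pose KX := [set x : 'rV['rV[R]_N]_m | forall i, K (x ord0 i)].
have cKX : compact KX by exact: (@rV_compact _ _ (fun=> K)).
pose h (z : 'rV[R]_m * 'rV['rV[R]_N]_m) := \sum_i z.1 0 i *: z.2 0 i.
have -> : convex_hull_upto K m = h @` (W1 `*` KX).
  apply/seteqP; split => v.
    move=> [w [x [w0 w1 xK ->]]]; exists (\row_i w i, \row_i x i).
      split; [split|] => /=.
      - move=> i; rewrite /= mxE in_itv/= w0/= -w1 (bigD1 i)//= lerDl.
        by rewrite sumr_ge0.
      - by rewrite -w1; apply: eq_bigr => i _; rewrite mxE.
      - by move=> i; rewrite mxE.
    by rewrite /h/=; apply: eq_bigr => i _; rewrite !mxE.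
  move=> [[w x] [[/= wW w1] xK] <-]; exists (w 0), (x 0); split => //.
  by move=> i; have := wW i; rewrite /= in_itv/= => /andP[].
apply: continuous_compact; last exact: compact_setX.
apply: continuous_subspaceT; apply: continuous_rowP => j.
rewrite /h; under eq_fun do rewrite summxE.
apply: continuous_sum => i z; under eq_fun do rewrite mxE.
apply: cvgM.
  apply: (@continuous_comp _ _ _ fst (fun M : 'rV[R]_m => M 0 i) z).
    exact: cvg_fst.
  exact: continuous_entry.
apply: (@continuous_comp _ _ _ snd (fun M : 'rV['rV[R]_N]_m => (M 0 i) 0 j) z).
  exact: cvg_snd.
apply: (@continuous_comp _ _ _ (fun M : 'rV['rV[R]_N]_m => M 0 i)
  (fun M : 'rV[R]_N => M 0 j)); exact: continuous_entry.
Qed.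

Lemma convex_hull_join (R : realType) (V : lmodType R) (K : set V) (m : nat)
  (c k : V) (t : R) :
  0 <= t <= 1 -> convex_hull_upto K m c -> K k ->
  convex_hull_upto K m.+1 (t *: k + (1 - t) *: c).
Proof.
move=> /andP[t0 t1] [w [x [w0 w1 xK ->]]] Kk.
exists (fun i => if unlift ord0 i is Some j then (1 - t) * w j else t),
  (fun i => if unlift ord0 i is Some j then x j else k); split.
- by move=> i; case: unliftP => // j _; rewrite mulr_ge0// subr_ge0.
- rewrite big_ord_recl unlift_none; under eq_bigr do rewrite liftK.
  by rewrite -mulr_sumr w1 mulr1 subrKC.
- by move=> i; case: unliftP.
- rewrite big_ord_recl unlift_none; under [in RHS]eq_bigr do rewrite liftK.
  rewrite scaler_sumr; congr (_ + _); apply: eq_bigr => j _.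
  by rewrite scalerA.
Qed.

(** Separation of a point from a compact convex set: the hull of K is compact by
    Caratheodory's theorem, so it has a point c nearest to v, and if c were not
    v the hypothesis on the form v - c would provide a nearer one. *)
Lemma mem_convex_hull_of_support (R : realType) (N : nat) (K : set 'rV[R]_N)
  (v : 'rV[R]_N) :
  compact K -> K !=set0 ->
  (forall l : 'rV[R]_N, exists2 k, K k &
     \sum_j l 0 j * v 0 j <= \sum_j l 0 j * k 0 j) ->
  exists m, convex_hull_upto K m v.
Proof.
move=> cK K0 vK; exists N.+1.
pose C := convex_hull_upto K N.+1.
have cC : compact C by exact: compact_convex_hull_upto.
have C0 : C !=set0.
  case: K0 => k Kk; exists k; exists (fun i => (i == ord0)%:R), (fun=> k).
  split => //.
  - by rewrite big_ord_recl eqxx big1 ?addr0.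
  - by rewrite big_ord_recl eqxx big1 ?addr0 ?scale1r// => i _; rewrite scale0r.
pose f (c : 'rV[R]_N) := \sum_j (v 0 j - c 0 j) ^+ 2.
have fc : continuous f.
  apply: continuous_sum => j c.
  apply: (@continuous_comp _ _ _ (fun c : 'rV[R]_N => v 0 j - c 0 j)
    (fun x => x ^+ 2)); last exact: exprn_continuous.
  by apply: continuousB; [exact: cst_continuous|exact: coord_continuous].
have [c Cc cmin] := compact_EVT_min C0 cC (continuous_subspaceT fc).
rewrite inE in Cc.
suff -> : v = c by exact: Cc.
apply: contrapT => vc.
(* Moving from c towards a k with (v - c).v <= (v - c).k decreases the
   squared distance to v, at first order by 2 t A. *)
pose l := v - c; have [k Kk lk] := vK l.
pose A := \sum_j l 0 j * (k 0 j - c 0 j).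
pose B := \sum_j (k 0 j - c 0 j) ^+ 2.
have fA : f c <= A.
  rewrite -subr_ge0 -sumrB.
  move: lk; rewrite -subr_ge0 -sumrB => /le_trans; apply.
  rewrite le_eqVlt; apply/orP; left; apply/eqP; apply: eq_bigr => j _.
  by rewrite !mxE; ring.
have f0 : 0 < f c.
  rewrite lt_neqAle sumr_ge0 ?andbT => [|j _]; last exact: sqr_ge0.
  apply/eqP => /esym f0; apply: vc; apply/rowP => j.
  have /eqP := @psumr_eq0P _ _ xpredT _
    (fun j _ => sqr_ge0 (v 0 j - c 0 j)) f0 j isT.
  by rewrite sqrf_eq0 subr_eq0 => /eqP.
have A0 : 0 < A by exact: lt_le_trans fA.
have B0 : 0 <= B by apply: sumr_ge0 => j _; exact: sqr_ge0.
(* Small enough for t ^+ 2 * B < 2 * t * A, and at most 1. *)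
pose t := A / (A + B).
have AB0 : 0 < A + B by rewrite ltr_wpDr.
have t0 : 0 < t by rewrite divr_gt0.
have t1 : t <= 1 by rewrite ler_pdivrMr// mul1r lerDl.
have /mem_set/cmin : C (t *: k + (1 - t) *: c).
  apply: (caratheodory K0 (m := N.+2)).
  by apply: convex_hull_join => //; rewrite (ltW t0).
have -> : f (t *: k + (1 - t) *: c) = f c - 2 * t * A + t ^+ 2 * B.
  rewrite /f /A /B !mulr_sumr -sumrB -big_split/=; apply: eq_bigr => j _.
  by rewrite !mxE; ring.
rewrite -subr_ge0.
have -> : f c - 2 * t * A + t ^+ 2 * B - f c = t * (t * B - 2 * A) by ring.
rewrite pmulr_rge0// subr_ge0 leNgt => /negP; apply.
apply: (@le_lt_trans _ _ A); last lra.
by rewrite /t mulrAC ler_pdivrMr// ler_pM2l// lerDr ltW.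
Qed.

(** * Real and complex scalars *)

Lemma toReal0 (R : realType) (s : scalars) : toReal (0 : scalarField R s) = 0.
Proof. by case: s. Qed.

Lemma toReal_ofReal (R : realType) (s : scalars) (r : R) :
  toReal (ofReal r : scalarField R s) = r.
Proof. by case: s. Qed.

Lemma toReal_ofRealM (R : realType) (s : scalars) (r : R)
  (z : scalarField R s) :
  toReal (ofReal r * z) = r * toReal z.
Proof. by case: s z => //= -[a b] /=; rewrite mul0r subr0. Qed.

Lemma ofReal0 (R : realType) (s : scalars) : ofReal 0 = 0 :> scalarField R s.
Proof. by case: s. Qed.

Lemma ofReal1 (R : realType) (s : scalars) : ofReal 1 = 1 :> scalarField R s.
Proof. by case: s. Qed.

Lemma toReal1 (R : realType) (s : scalars) : toReal (1 : scalarField R s) = 1.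
Proof. by rewrite -(ofReal1 R s) toReal_ofReal. Qed.

Lemma ofRealD (R : realType) (s : scalars) (x y : R) :
  ofReal (x + y) = ofReal x + ofReal y :> scalarField R s.
Proof. by case: s => //=; rewrite -rmorphD. Qed.

Lemma ofRealM (R : realType) (s : scalars) (x y : R) :
  ofReal (x * y) = ofReal x * ofReal y :> scalarField R s.
Proof. by case: s => //=; rewrite -rmorphM. Qed.

Lemma ofRealN (R : realType) (s : scalars) (x : R) :
  ofReal (- x) = - ofReal x :> scalarField R s.
Proof. by case: s => //=; rewrite -rmorphN. Qed.

Lemma ofReal_inj (R : realType) (s : scalars) :
  injective (@ofReal R s).
Proof. by move=> x y /(congr1 toReal); rewrite !toReal_ofReal. Qed.

Lemma ofReal_sum (R : realType) (s : scalars) (I : finType) (f : I -> R) :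
  ofReal (\sum_i f i) = \sum_i ofReal (f i) :> scalarField R s.
Proof. exact: (big_morph _ (@ofRealD R s) (@ofReal0 R s)). Qed.

Lemma toReal_sum (R : realType) (s : scalars) (I : finType)
  (f : I -> scalarField R s) :
  toReal (\sum_i f i) = \sum_i toReal (f i).
Proof. exact: (big_morph _ (@toRealD R s) (@toReal0 R s)). Qed.

Lemma toRealN (R : realType) (s : scalars) (z : scalarField R s) :
  toReal (- z) = - toReal z.
Proof. by case: s z => //= -[]. Qed.

Lemma ofReal_toReal_ge0 (R : realType) (s : scalars) (z : scalarField R s) :
  0 <= z -> ofReal (toReal z) = z.
Proof.
by case: s z => //= -[a b]; rewrite lecE /= => /andP[/eqP -> _].
Qed.

Lemma norm_ofReal (R : realType) (s : scalars)
  (W : normedModType (scalarField R s)) (x : W) : `|x| = ofReal (rnorm x).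
Proof. by rewrite /rnorm ofReal_toReal_ge0. Qed.

Lemma rnorm_ge0 (R : realType) (s : scalars)
  (W : normedModType (scalarField R s)) (x : W) : 0 <= rnorm x.
Proof. by rewrite -(toReal0 R s); apply: toReal_le. Qed.

Lemma rnorm0_eq0 (R : realType) (s : scalars)
  (W : normedModType (scalarField R s)) (x : W) : rnorm x = 0 -> x = 0.
Proof.
by move=> x0; apply/eqP; rewrite -normr_eq0 norm_ofReal x0 ofReal0.
Qed.

Lemma rnorm_sum (R : realType) (s : scalars)
  (W : normedModType (scalarField R s)) (I : finType) (f : I -> W) :
  rnorm (\sum_i f i) <= \sum_i rnorm (f i).
Proof.
elim/big_rec2: _ => [|i r z _ rz]; first by rewrite rnorm0.
by rewrite (le_trans (rnormD _ _))// lerD2l.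
Qed.

Lemma rnormN (R : realType) (s : scalars)
  (W : normedModType (scalarField R s)) (x : W) : rnorm (- x) = rnorm x.
Proof. by rewrite /rnorm normrN. Qed.

Lemma modulusE (R : realType) (s : scalars) (z : scalarField R s) :
  ofReal (modulus z) = `|z|.
Proof. by rewrite /modulus -norm_ofReal. Qed.

Lemma modulusM (R : realType) (s : scalars) (x y : scalarField R s) :
  modulus (x * y) = modulus x * modulus y.
Proof. by apply: (@ofReal_inj R s); rewrite ofRealM !modulusE normrM. Qed.

Lemma modulus_ofReal (R : realType) (s : scalars) (r : R) :
  modulus (ofReal r : scalarField R s) = `|r|.
Proof.
have H (x : R) : 0 <= x -> modulus (ofReal x : scalarField R s) = x.
  move=> x0; apply: (@ofReal_inj R s); rewrite modulusE ger0_norm//.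
  by case: s => //=; rewrite lecE /= eqxx.
have [/[dup] r0 /ger0_norm->|/[dup] /ltW r0 /ltr0_norm->] := leP 0 r.
  exact: H.
rewrite -(H (- r)) ?oppr_ge0//; apply: (@ofReal_inj R s).
by rewrite !modulusE ofRealN normrN.
Qed.

Lemma modulus_ofReal_ge0 (R : realType) (s : scalars) (r : R) :
  0 <= r -> modulus (ofReal r : scalarField R s) = r.
Proof. by move=> r0; rewrite modulus_ofReal ger0_norm. Qed.

Lemma modulus0 (R : realType) (s : scalars) : modulus (0 : scalarField R s) = 0.
Proof. by rewrite -(ofReal0 R s) modulus_ofReal normr0. Qed.

Lemma modulus1 (R : realType) (s : scalars) : modulus (1 : scalarField R s) = 1.
Proof. by rewrite -(ofReal1 R s) modulus_ofReal normr1. Qed.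

Lemma modulusN (R : realType) (s : scalars) (z : scalarField R s) :
  modulus (- z) = modulus z.
Proof. by apply: (@ofReal_inj R s); rewrite !modulusE normrN. Qed.

Lemma modulus_sum (R : realType) (s : scalars) (I : finType)
  (f : I -> scalarField R s) :
  modulus (\sum_i f i) <= \sum_i modulus (f i).
Proof. exact: rnorm_sum. Qed.

Lemma modulus_eq0 (R : realType) (s : scalars) (z : scalarField R s) :
  modulus z = 0 -> z = 0.
Proof. exact: rnorm0_eq0. Qed.

Lemma ler_toReal_modulus (R : realType) (s : scalars) (z : scalarField R s) :
  toReal z <= modulus z.
Proof.
case: s z => [z|[a b]]; first exact: ler_norm.
rewrite (_ : modulus _ = Num.sqrt (a ^+ 2 + b ^+ 2))//=.
rewrite (le_trans (ler_norm _))// -sqrtr_sqr ler_wsqrtr// lerDl sqr_ge0//.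
Qed.

Lemma ler_norm_toReal (R : realType) (s : scalars) (z : scalarField R s) :
  `|toReal z| <= modulus z.
Proof.
rewrite ler_norml ler_toReal_modulus andbT lerNl -toRealN -modulusN.
exact: ler_toReal_modulus.
Qed.

Lemma toReal_eq_modulus (R : realType) (s : scalars) (z : scalarField R s) :
  toReal z = modulus z -> z = ofReal (modulus z).
Proof.
case: s z => [z /= <-//|[a b]].
rewrite (_ : modulus _ = Num.sqrt (a ^+ 2 + b ^+ 2))//= => ab.
have := sqr_sqrtr (addr_ge0 (sqr_ge0 a) (sqr_ge0 b)).
rewrite -ab => /eqP; rewrite -subr_eq0 opprD addNKr oppr_eq0 sqrf_eq0.
by move=> /eqP->.
Qed.

Lemma scalar_eq1 (R : realType) (s : scalars) (z : scalarField R s) :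
  modulus z <= 1 -> 1 <= toReal z -> z = 1.
Proof.
move=> z1 z2.
have zE : modulus z = 1.
  by apply/eqP; rewrite eq_le z1 (le_trans z2)// ler_toReal_modulus.
rewrite -(ofReal1 R s) -zE; apply: toReal_eq_modulus; apply/eqP.
by rewrite eq_le ler_toReal_modulus zE z2.
Qed.

(** Real parts at most 1 whose average is 1 are equal to 1. *)
Lemma convex_scalar_eq1 (R : realType) (s : scalars) (t : R)
  (z1 z2 : scalarField R s) : 0 < t < 1 ->
  modulus z1 <= 1 -> modulus z2 <= 1 ->
  ofReal t * z1 + ofReal (1 - t) * z2 = 1 -> z1 = 1 /\ z2 = 1.
Proof.
move=> /andP[t0 t1] m1 m2 /(congr1 toReal).
rewrite toRealD !toReal_ofRealM toReal1 => zE.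
have r1 := le_trans (ler_toReal_modulus z1) m1.
have r2 := le_trans (ler_toReal_modulus z2) m2.
split; apply: scalar_eq1 => //; nra.
Qed.

Lemma phase_exists (R : realType) (s : scalars) (z : scalarField R s) :
  exists2 u : scalarField R s, modulus u = 1 & u * z = ofReal (modulus z).
Proof.
have [->|z0] := eqVneq z 0.
  by exists 1; rewrite ?modulus1// mulr0 modulus0 ofReal0.
exists (`|z| / z); last by rewrite divfK// modulusE.
apply: (@ofReal_inj R s); rewrite modulusE ofReal1 normrM normr_id normfV.
by rewrite divff// normr_eq0.
Qed.

(** Multiplying by a phase turns a bound on real parts into one on moduli. *)
Lemma toReal_bound_modulus (R : realType) (s : scalars)
  (V : lmodType (scalarField R s)) (f : V -> (scalarField R s)^o) (N : V -> R) :
  linear f -> (forall a v, modulus a = 1 -> N (a *: v) = N v) ->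
  (forall v, toReal (f v) <= N v) -> forall v, modulus (f v) <= N v.
Proof.
move=> lf NZ fN v; have [u u1 uf] := phase_exists (f v).
pose fL : {linear V -> (scalarField R s)^o} :=
  HB.pack f (GRing.isLinear.Build _ _ _ _ f lf).
rewrite -(toReal_ofReal s (modulus _)) -uf.
have -> : u * f v = f (u *: v) by rewrite -[RHS]/(fL _) linearZ.
by rewrite (le_trans (fN _))// NZ.
Qed.

(** The imaginary part of z is read as - Re (i z), which the value 0 in the real
    case makes vanish; both cases then share the formulas below. *)
Definition imaginary_unit (R : realType) (s : scalars) : scalarField R s :=
  match s with RealScalars => 0 | ComplexScalars => ('i)%C end.

Lemma modulus_imaginary_unit (R : realType) (s : scalars) :
  modulus (imaginary_unit R s) <= 1.
Proof.
case: s; first by rewrite (modulus0 R RealScalars).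
rewrite -[leLHS]/(Num.sqrt (0 ^+ 2 + 1 ^+ 2)).
by rewrite expr0n expr1n add0r sqrtr1.
Qed.

Lemma scalar_decomposition (R : realType) (s : scalars) (z : scalarField R s) :
  z = ofReal (toReal z)
      - imaginary_unit R s * ofReal (toReal (imaginary_unit R s * z)).
Proof.
case: s z => [z|[a b]] /=; first by rewrite mul0r subr0.
apply/eqP; rewrite eq_complex /=.
by rewrite !(mul0r, mul1r, mulr0, subr0, addr0, sub0r, opprK) !eqxx.
Qed.

Lemma toRealM (R : realType) (s : scalars) (x y : scalarField R s) :
  toReal (x * y) =
  toReal x * toReal y -
  toReal (imaginary_unit R s * x) * toReal (imaginary_unit R s * y).
Proof.
case: s x y => /= [x y|[a b] [c e]/=]; first by rewrite !mul0r subr0.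
by ring.
Qed.

Lemma toReal_imagM (R : realType) (s : scalars) (x y : scalarField R s) :
  toReal (imaginary_unit R s * (x * y)) =
  toReal (imaginary_unit R s * x) * toReal y +
  toReal x * toReal (imaginary_unit R s * y).
Proof.
case: s x y => /= [x y|[a b] [c e]/=]; first by rewrite !mul0r mulr0 addr0.
by ring.
Qed.

(** Reading continuity on the real parts of g and of i g treats real and complex
    scalars alike. *)
Definition scalar_continuous (R : realType) (s : scalars) (T : topologicalType)
  (g : T -> scalarField R s) : Prop :=
  continuous (fun t => toReal (g t)) /\
  continuous (fun t => toReal (imaginary_unit R s * g t)).

Section ScalarContinuous.
Variables (R : realType) (s : scalars) (T : topologicalType).
Local Notation F := (scalarField R s).

Lemma scalar_continuous_cst (z : F) : scalar_continuous (fun _ : T => z).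
Proof. by split; exact: cst_continuous. Qed.

Lemma scalar_continuous_sum (I : finType) (g : I -> T -> F) :
  (forall i, scalar_continuous (g i)) ->
  scalar_continuous (fun t => \sum_i g i t).
Proof.
move=> gc; split.
  under eq_fun do rewrite toReal_sum.
  by apply: continuous_sum => i; case: (gc i).
under eq_fun do rewrite mulr_sumr toReal_sum.
by apply: continuous_sum => i; case: (gc i).
Qed.

Lemma scalar_continuousM (f g : T -> F) : scalar_continuous f ->
  scalar_continuous g -> scalar_continuous (fun t => f t * g t).
Proof.
move=> [f1 f2] [g1 g2]; split.
  under eq_fun do rewrite toRealM.
  apply: continuous_subr; exact: continuous_mulr.
under eq_fun do rewrite toReal_imagM.
apply: continuous_addr; exact: continuous_mulr.
Qed.

Lemma scalar_continuous_ofReal (g : T -> R) : continuous g ->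
  scalar_continuous (fun t => ofReal (g t) : F).
Proof.
move=> gc; split; first by under eq_fun do rewrite toReal_ofReal.
under eq_fun do rewrite mulrC toReal_ofRealM.
by apply: continuous_mulr => //; exact: cst_continuous.
Qed.

Lemma scalar_continuous_comp (U : topologicalType) (h : U -> T) (g : T -> F) :
  continuous h -> scalar_continuous g -> scalar_continuous (g \o h).
Proof.
move=> hc [g1 g2]; split=> u.
  by apply: (@continuous_comp _ _ _ h (fun t => toReal (g t)));
    [exact: hc|exact: g1].
by apply: (@continuous_comp _ _ _ h
  (fun t => toReal (imaginary_unit R s * g t))); [exact: hc|exact: g2].
Qed.

End ScalarContinuous.

(** Codes give compactness for real and complex scalars at once: bounding both
    rows in [code_box] makes the set of codes a product of real cubes. *)
Definition decode_row (R : realType) (s : scalars) (k : nat)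
  (z : 'rV[R]_k * 'rV[R]_k) (i : 'I_k) : scalarField R s :=
  ofReal (z.1 0 i) - imaginary_unit R s * ofReal (z.2 0 i).

Definition encode_row (R : realType) (s : scalars) (k : nat)
  (c : 'I_k -> scalarField R s) : 'rV[R]_k * 'rV[R]_k :=
  (\row_i toReal (c i), \row_i toReal (imaginary_unit R s * c i)).

Section Codes.
Variables (R : realType) (s : scalars) (k : nat).
Local Notation F := (scalarField R s).

Lemma encode_rowK (c : 'I_k -> F) i : decode_row s (encode_row c) i = c i.
Proof. by rewrite /decode_row !mxE [RHS]scalar_decomposition. Qed.

Definition code_box (C : R) : set ('rV[R]_k * 'rV[R]_k) :=
  [set z : 'rV[R]_k * 'rV[R]_k |
    forall i, `|z.1 ord0 i| <= C /\ `|z.2 ord0 i| <= C].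

Lemma compact_code_box C : compact (code_box C).
Proof.
pose B := [set w : 'rV[R]_k | forall i, `[- C, C]%classic (w ord0 i)].
rewrite (_ : code_box C = B `*` B).
  by apply: compact_setX; exact: compact_cube.
apply/seteqP; split => [[z1 z2] zC|[z1 z2] [z1C z2C] i].
  by split=> i /=; have [] := zC i; rewrite in_itv/= !ler_norml.
by move: (z1C i) (z2C i); rewrite /= !in_itv/= !ler_norml.
Qed.

Lemma code_box_encode C (c : 'I_k -> F) :
  (forall i, modulus (c i) <= C) -> code_box C (encode_row c).
Proof.
move=> cC i; rewrite !mxE; split; first exact: le_trans (ler_norm_toReal _) _.
apply: le_trans (ler_norm_toReal _) _; rewrite modulusM (le_trans _ (cC i))//.
by rewrite ler_piMl ?modulus_ge0// modulus_imaginary_unit.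
Qed.

Lemma scalar_continuous_decode_row i :
  scalar_continuous (fun z : 'rV[R]_k * 'rV[R]_k => decode_row s z i).
Proof.
have c1 : continuous (fun z : 'rV[R]_k * 'rV[R]_k => z.1 0 i).
  move=> z; apply: (@continuous_comp _ _ _ fst (fun M : 'rV[R]_k => M 0 i) z).
    exact: cvg_fst.
  exact: coord_continuous.
have c2 : continuous (fun z : 'rV[R]_k * 'rV[R]_k => - z.2 0 i).
  move=> z; apply: continuousN.
  apply: (@continuous_comp _ _ _ snd (fun M : 'rV[R]_k => M 0 i) z).
    exact: cvg_snd.
  exact: coord_continuous.
have := scalar_continuousM (scalar_continuous_cst _ (imaginary_unit R s))
  (scalar_continuous_ofReal s c2).
have := scalar_continuous_ofReal s c1.
rewrite /decode_row => -[f1 f2] [g1 g2]; split.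
  under eq_fun do rewrite -mulrN -ofRealN toRealD.
  exact: continuous_addr.
under eq_fun do rewrite -mulrN -ofRealN mulrDr toRealD.
exact: continuous_addr.
Qed.

End Codes.

(** * Duality of l_p and l_q *)

(** Strict convexity of the exponential gives the equality case of Young's
    inequality. *)
Lemma young_eq (R : realType) (a b p q : R) :
  0 <= a -> 0 <= b -> 0 < p -> 0 < q -> p^-1 + q^-1 = 1 ->
  a `^ p / p + b `^ q / q <= a * b -> a `^ p = b `^ q.
Proof.
rewrite le_eqVlt => /predU1P[<- b0 p0 q0 _|a0].
  rewrite mul0r powR0 ?gt_eqF// mul0r add0r => bq; apply/eqP.
  by rewrite eq_le powR_ge0 -(@pmulr_lle0 _ q^-1) ?invr_gt0.
rewrite le_eqVlt => /predU1P[<-|b0] p0 q0 pq.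
  rewrite mulr0 powR0 ?(gt_eqF q0)// mul0r addr0 => ap; apply/eqP.
  by rewrite eq_le powR_ge0 andbT -(@pmulr_lle0 _ p^-1) ?invr_gt0.
move=> ab; apply/eqP/negP => /negP neq.
(* a ^ p = e^u, b ^ q = e^v and a b = e^m, where m is the mean of u and v;
   compare e^u and e^v with the tangent of exp at m. *)
pose u := p * ln a; pose v := q * ln b; pose m := u / p + v / q.
have abE : a * b = expR m.
  rewrite /m /u /v mulrAC divff ?gt_eqF// mul1r mulrAC divff ?gt_eqF// mul1r.
  by rewrite expRD !lnK.
have apE : a `^ p = expR u by rewrite /powR gt_eqF.
have bqE : b `^ q = expR v by rewrite /powR gt_eqF.
have uv : u != v by move: neq; rewrite apE bqE; apply: contraNneq => ->.
have um : u - m != 0.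
  have -> : u - m = (u - v) / q.
    have p1 : p^-1 = 1 - q^-1 by rewrite -pq addrK.
    by rewrite /m p1; ring.
  by rewrite mulf_neq0 ?invr_eq0 ?(gt_eqF q0)// subr_eq0.
have mE : u / p + v / q = m by [].
clearbody m; move: ab; rewrite abE apE bqE leNgt => /negP; apply.
have hu : expR m * (1 + (u - m)) < expR u.
  have -> : expR u = expR m * expR (u - m) by rewrite -expRD; congr expR; ring.
  by rewrite ltr_pM2l ?expR_gt0// expR_gt1Dx.
have hv : expR m * (1 + (v - m)) <= expR v.
  have -> : expR v = expR m * expR (v - m) by rewrite -expRD; congr expR; ring.
  by rewrite ler_pM2l ?expR_gt0// expR_ge1Dx.
apply: (@le_lt_trans _ _ (expR m * (1 + (u - m)) / p +
  expR m * (1 + (v - m)) / q)).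
  rewrite le_eqVlt; apply/orP; left; apply/eqP.
  have -> : expR m * (1 + (u - m)) / p + expR m * (1 + (v - m)) / q
          = expR m * ((p^-1 + q^-1) * (1 - m) + (u / p + v / q)) by ring.
  by rewrite pq mE; ring.
apply: ltr_leD; first by rewrite ltr_pM2r ?invr_gt0.
by rewrite ler_pM2r ?invr_gt0.
Qed.

Lemma lp_norm_ge0 (R : realType) (s : scalars) (d : nat) (p : R)
  (a : 'I_d -> scalarField R s) : 0 <= lp_norm p a.
Proof. exact: powR_ge0. Qed.

Lemma lp_norm_le (R : realType) (s : scalars) (d : nat) (p : R)
  (a b : 'I_d -> scalarField R s) : 0 < p ->
  (forall i, modulus (a i) <= modulus (b i)) -> lp_norm p a <= lp_norm p b.
Proof.
move=> p0 ab; apply: ge0_ler_powR; rewrite ?invr_ge0 ?(ltW p0)// ?nnegrE.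
- by apply: sumr_ge0 => i _; exact: powR_ge0.
- by apply: sumr_ge0 => i _; exact: powR_ge0.
- apply: ler_sum => i _; apply: ge0_ler_powR; rewrite ?nnegrE ?modulus_ge0//.
  exact: ltW.
Qed.

Lemma lp_norm_powR (R : realType) (s : scalars) (d : nat) (p : R)
  (a : 'I_d -> scalarField R s) : p != 0 ->
  lp_norm p a `^ p = \sum_i modulus (a i) `^ p.
Proof.
move=> p0; rewrite /lp_norm -powRrM mulVf// powRr1//.
by apply: sumr_ge0 => i _; exact: powR_ge0.
Qed.

Lemma lp_normZ (R : realType) (s : scalars) (d : nat) (p : R)
  (z : scalarField R s) (a : 'I_d -> scalarField R s) : p != 0 ->
  lp_norm p (fun i => z * a i) = modulus z * lp_norm p a.
Proof.
move=> p0; rewrite /lp_norm.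
under eq_bigr do rewrite modulusM powRM ?modulus_ge0//.
rewrite -mulr_sumr powRM ?powR_ge0//; last first.
  by apply: sumr_ge0 => i _; exact: powR_ge0.
by rewrite -powRrM mulfV// powRr1// modulus_ge0.
Qed.

Lemma lp_norm_eq0 (R : realType) (s : scalars) (d : nat) (p : R)
  (a : 'I_d -> scalarField R s) : p != 0 ->
  lp_norm p a = 0 -> forall i, a i = 0.
Proof.
move=> p0 /(congr1 (@powR R ^~ p)); rewrite lp_norm_powR// powR0// => a0 i.
apply: modulus_eq0; apply: (@powR_eq0_eq0 _ _ p).
exact: (@psumr_eq0P _ _ xpredT _ (fun i _ => powR_ge0 _ _) a0 i isT).
Qed.

Lemma lp_norm_neq0 (R : realType) (s : scalars) (d : nat) (p : R)
  (a : 'I_d -> scalarField R s) : p != 0 ->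
  lp_norm p a != 0 -> exists i, a i != 0.
Proof.
move=> p0 /eqP an0; apply: contrapT => /forallNP a0; apply: an0.
rewrite /lp_norm big1 ?powR0 ?invr_eq0// => i _.
have /negP := a0 i; rewrite negbK => /eqP->.
by rewrite modulus0 powR0.
Qed.

Lemma sum_powR_le1 (R : realType) (s : scalars) (d : nat) (p : R)
  (a : 'I_d -> scalarField R s) : 0 < p ->
  lp_norm p a <= 1 -> \sum_i modulus (a i) `^ p <= 1.
Proof.
move=> p0 a1; rewrite -lp_norm_powR ?gt_eqF//.
have -> : 1 = 1 `^ p :> R by rewrite powR1.
by apply: ge0_ler_powR; rewrite ?nnegrE ?lp_norm_ge0// ltW.
Qed.

Lemma lp_norm_normalize (R : realType) (s : scalars) (d : nat) (p : R)
  (a : 'I_d -> scalarField R s) : 0 < p -> 0 < lp_norm p a ->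
  lp_norm p (fun i => ofReal (lp_norm p a)^-1 * a i) = 1.
Proof.
move=> p0; rewrite lp_normZ ?gt_eqF//; move: (lp_norm p a) => A A0.
by rewrite modulus_ofReal_ge0 ?invr_ge0 1?ltW// mulVf// gt_eqF.
Qed.

Lemma lp_norm_single (R : realType) (s : scalars) (d : nat) (q : R)
  (i0 : 'I_d) : 0 < q ->
  lp_norm q (fun i => (i == i0)%:R : scalarField R s) = 1.
Proof.
move=> q0; rewrite /lp_norm (bigD1 i0)//= big1 => [|i ii0].
  by rewrite eqxx addr0 modulus1 !powR1.
by rewrite (negbTE ii0) modulus0 powR0// gt_eqF.
Qed.

Lemma lp_ball_modulus (R : realType) (s : scalars) (d : nat) (q : R)
  (a : 'I_d -> scalarField R s) i : 0 < q ->
  lp_norm q a <= 1 -> modulus (a i) <= 1.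
Proof.
move=> q0 /(sum_powR_le1 q0); rewrite (bigD1 i)//= => a1.
rewrite leNgt; apply/negP => ai1.
have : 1 < modulus (a i) `^ q.
  have -> : 1 = 1 `^ q :> R by rewrite powR1.
  by apply: gt0_ltr_powR; rewrite ?nnegrE ?modulus_ge0.
rewrite ltNge => /negP; apply; apply: le_trans a1; rewrite lerDl.
by apply: sumr_ge0 => j _; exact: powR_ge0.
Qed.

Section HoelderConjugates.
Variables (R : realType) (s : scalars) (d : nat) (p q : R).
Hypotheses (p0 : 0 < p) (q0 : 0 < q) (pq : p^-1 + q^-1 = 1).
Local Notation F := (scalarField R s).
Implicit Types a c : 'I_d -> F.

Lemma hoelder_unit a c : lp_norm q a <= 1 -> lp_norm p c <= 1 ->
  \sum_i modulus (a i * c i) <= 1.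
Proof.
move=> a1 c1.
have qa : \sum_i modulus (a i) `^ q <= 1 by exact: sum_powR_le1.
have pc : \sum_i modulus (c i) `^ p <= 1 by exact: sum_powR_le1.
apply: (@le_trans _ _
  (\sum_i (modulus (c i) `^ p / p + modulus (a i) `^ q / q))).
  apply: ler_sum => i _; rewrite modulusM mulrC.
  by apply: conjugate_powR; rewrite ?modulus_ge0.
rewrite big_split/= -!mulr_suml -pq; apply: lerD.
  by rewrite ler_piMl// invr_ge0 ltW.
by rewrite ler_piMl// invr_ge0 ltW.
Qed.

Lemma hoelder_lp_norm a c :
  modulus (\sum_i a i * c i) <= lp_norm q a * lp_norm p c.
Proof.
have [a0|/eqP a0] := pselect (lp_norm q a = 0).
  rewrite big1 ?modulus0 ?mulr_ge0 ?lp_norm_ge0// => i _.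
  by rewrite (lp_norm_eq0 _ a0) ?mul0r// gt_eqF.
have [c0|/eqP c0] := pselect (lp_norm p c = 0).
  rewrite big1 ?modulus0 ?mulr_ge0 ?lp_norm_ge0// => i _.
  by rewrite (lp_norm_eq0 _ c0) ?mulr0// gt_eqF.
have {}a0 : 0 < lp_norm q a by rewrite lt_neqAle eq_sym a0 lp_norm_ge0.
have {}c0 : 0 < lp_norm p c by rewrite lt_neqAle eq_sym c0 lp_norm_ge0.
have eq_le1 (x : R) : x = 1 -> x <= 1 by move=> ->.
have := hoelder_unit (eq_le1 _ (lp_norm_normalize q0 a0))
  (eq_le1 _ (lp_norm_normalize p0 c0)).
move: (lp_norm q a) (lp_norm p c) a0 c0 => A C a0 c0.
rewrite (eq_bigr (fun i => (A * C)^-1 * modulus (a i * c i))); last first.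
  move=> i _; rewrite !modulusM !modulus_ofReal_ge0 ?invr_ge0 1?ltW//.
  by rewrite invfM mulrACA.
rewrite -mulr_sumr ler_pdivrMl ?mulr_gt0// mulr1.
by apply: le_trans; exact: modulus_sum.
Qed.

(** The ball of l_q is strictly convex: equality in Hoelder's inequality forces
    equality in each instance of Young's, which determines the moduli of the
    entries, while the phases are those that make a_i c_i nonnegative. *)
Lemma hoelder_eq a a' c :
  lp_norm q a <= 1 -> lp_norm q a' <= 1 -> lp_norm p c <= 1 ->
  toReal (\sum_i a i * c i) = 1 -> toReal (\sum_i a' i * c i) = 1 ->
  forall i, a i = a' i.
Proof.
move=> a1 a1' c1 ac ac' i.
have pc : \sum_i modulus (c i) `^ p <= 1 by exact: sum_powR_le1.
suff H b : lp_norm q b <= 1 -> toReal (\sum_i b i * c i) = 1 ->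
    b i * c i = ofReal (modulus (b i * c i)) /\
    modulus (c i) `^ p = modulus (b i) `^ q.
  have [aE apE] := H a a1 ac; have [aE' apE'] := H a' a1' ac'.
  have modE : modulus (a i) = modulus (a' i).
    by apply: (powR_injective q0); rewrite ?nnegrE ?modulus_ge0// -apE -apE'.
  have [ci0|ci0] := eqVneq (c i) 0.
    move: apE apE'; rewrite ci0 modulus0 powR0 ?gt_eqF// => /esym/powR_eq0_eq0.
    by move=> /modulus_eq0-> /esym/powR_eq0_eq0/modulus_eq0->.
  by apply: (mulIf ci0); rewrite aE aE' !modulusM modE.
move=> b1 bc.
have qb : \sum_i modulus (b i) `^ q <= 1 by exact: sum_powR_le1.
pose y i := modulus (c i) `^ p / p + modulus (b i) `^ q / q.
have yle i' : modulus (b i' * c i') <= y i'.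
  by rewrite modulusM mulrC conjugate_powR ?modulus_ge0.
have Sy : \sum_i y i <= 1.
  rewrite big_split/= -!mulr_suml -pq; apply: lerD.
    by rewrite ler_piMl// invr_ge0 ltW.
  by rewrite ler_piMl// invr_ge0 ltW.
have ge0 i' : 0 <= y i' - toReal (b i' * c i').
  by rewrite subr_ge0 (le_trans _ (yle i'))// ler_toReal_modulus.
have S0 : \sum_i (y i - toReal (b i * c i)) = 0.
  apply/eqP; rewrite eq_le sumr_ge0 ?andbT// sumrB -toReal_sum bc.
  by rewrite subr_le0.
have := @psumr_eq0P _ _ xpredT _ (fun i _ => ge0 i) S0 i isT.
move=> /eqP; rewrite subr_eq0 => /eqP yE.
have tE : toReal (b i * c i) = modulus (b i * c i).
  by apply/eqP; rewrite eq_le ler_toReal_modulus -yE yle.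
split; first exact: toReal_eq_modulus.
apply: young_eq; rewrite ?modulus_ge0//.
by rewrite -/(y i) yE tE modulusM mulrC.
Qed.

Lemma hoelder_norming c : exists2 a, lp_norm q a <= 1 &
  \sum_i a i * c i = ofReal (lp_norm p c).
Proof.
have [c0|/eqP c0] := pselect (lp_norm p c = 0).
  exists (fun=> 0).
    rewrite /lp_norm big1 ?powR0 ?invr_eq0 ?gt_eqF// => i _.
    by rewrite modulus0 powR0 ?gt_eqF.
  by rewrite c0 ofReal0 big1// => i _; rewrite mul0r.
have {}c0 : 0 < lp_norm p c by rewrite lt_neqAle eq_sym c0 lp_norm_ge0.
set P := lp_norm p c in c0 *.
pose u i := sval (cid2 (phase_exists (c i))).
have u1 i : modulus (u i) = 1 by rewrite /u; case: cid2.
have uc i : u i * c i = ofReal (modulus (c i)) by rewrite /u; case: cid2.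
(* a_i will be the phase of c_i times r_i ^ (p - 1); its q-th power is r_i ^ p
   since (p - 1) q = p. *)
pose r i := modulus (c i) / P.
have r0 i : 0 <= r i by rewrite divr_ge0 ?modulus_ge0// ltW.
have rP i : modulus (c i) = P * r i by rewrite mulrC divfK ?gt_eqF.
have Sr : \sum_i r i `^ p = 1.
  have Pp0 : P `^ p != 0 by apply: lt0r_neq0; exact: powR_gt0.
  apply: (mulfI Pp0).
  rewrite mulr1 mulr_sumr [RHS]lp_norm_powR ?gt_eqF//.
  by apply: eq_bigr => i _; rewrite rP powRM ?r0// ltW.
have pq1 : (p - 1) * q = p.
  have -> : (p - 1) * q = p * q * (1 - p^-1) by field; rewrite gt_eqF.
  by rewrite -pq addrAC subrr add0r mulfK ?gt_eqF.
exists (fun i => u i * ofReal (r i `^ (p - 1))).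
  rewrite /lp_norm [X in X `^ _](_ : _ = 1) ?powR1// -[RHS]Sr.
  apply: eq_bigr => i _; rewrite modulusM u1 mul1r.
  by rewrite modulus_ofReal_ge0 ?powR_ge0// -powRrM pq1.
have -> : P = \sum_i P * r i `^ p by rewrite -mulr_sumr Sr mulr1.
rewrite ofReal_sum; apply: eq_bigr => i _.
rewrite mulrAC uc -ofRealM; congr ofReal.
rewrite rP -mulrA; congr (_ * _).
have [ri0|ri0] := eqVneq (r i) 0; first by rewrite ri0 mul0r powR0 ?gt_eqF.
rewrite -[X in X * _](powRr1 (r0 i)) -powRD ?ri0 ?implybT//.
by congr (_ `^ _); ring.
Qed.

End HoelderConjugates.

(** This description of the ball of l_q by linear inequalities shows that it is
    closed. *)
Lemma lp_ballP (R : realType) (s : scalars) (d : nat) (p q : R)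
  (a : 'I_d -> scalarField R s) :
  0 < p -> 0 < q -> p^-1 + q^-1 = 1 ->
  lp_norm q a <= 1 <-> forall c : 'I_d -> scalarField R s,
    toReal (\sum_i a i * c i) <= lp_norm p c.
Proof.
move=> p0 q0 pq; split=> [a1 c|ac].
  apply: le_trans (ler_toReal_modulus _) _.
  apply: le_trans (hoelder_lp_norm p0 q0 pq _ _) _.
  by rewrite ler_piMl// lp_norm_ge0.
have qp : q^-1 + p^-1 = 1 by rewrite addrC.
have [c c1 ca] := hoelder_norming q0 p0 qp a.
rewrite -[leLHS](toReal_ofReal s) -ca; apply: le_trans c1.
by under eq_bigr do rewrite mulrC; exact: ac.
Qed.

(** * Coordinates in a finite-dimensional normed space *)

Definition real_comb (R : realType) (s : scalars)
  (V : lmodType (scalarField R s)) (m : nat) (b : 'I_m -> V)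
  (r : 'rV[R]_m) : V :=
  \sum_j ofReal (r 0 j) *: b j.

Lemma real_coordinates (R : realType) (s : scalars)
  (V : lmodType (scalarField R s)) (n : nat) : has_dim V n ->
  exists m (b : 'I_m -> V) (coord : V -> 'rV[R]_m),
    cancel coord (real_comb b) /\ cancel (real_comb b) coord.
Proof.
case=> f lf [r2v fK r2vK].
pose v2r : {linear V -> 'rV_n} := HB.pack f (GRing.isLinear.Build _ _ _ _ f lf).
have {fK} v2rK : cancel v2r r2v by [].
have {r2vK} r2vK : cancel r2v v2r by [].
clearbody v2r; clear f lf.
pose e j := r2v (delta_mx 0 j).
have v2re j k : v2r (e j) 0 k = (k == j)%:R by rewrite r2vK mxE eqxx.
have v2r_sum (c : 'I_n -> scalarField R s) k :
    v2r (\sum_j c j *: e j) 0 k = c k.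
  rewrite linear_sum summxE (bigD1 k)//= big1 => [|j jk].
    by rewrite linearZ mxE v2re eqxx mulr1 addr0.
  by rewrite linearZ mxE v2re eq_sym (negbTE jk) mulr0.
case: s V v2r r2v v2rK r2vK e v2re v2r_sum
  => V v2r r2v v2rK r2vK e v2re v2r_sum.
  have eK : cancel (real_comb e) v2r.
    by move=> r; apply/rowP => k; rewrite v2r_sum.
  exists n, e, v2r; split => // v.
  by apply: (can_inj v2rK); rewrite eK.
pose b (j : 'I_(n + n)) : V := match fintype.split j with
  | inl k => e k | inr k => imaginary_unit R ComplexScalars *: e k end.
pose co (v : V) : 'rV[R]_(n + n) := row_mx (\row_k complex.Re (v2r v 0 k))
   (\row_k complex.Im (v2r v 0 k)).
have v2rb r k : v2r (real_comb b r) 0 k =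
    ((r 0 (lshift n k)) +i* (r 0 (rshift n k)))%C.
  rewrite -(v2r_sum (fun k => (r 0 (lshift n k) +i* r 0 (rshift n k))%C)).
  congr (fun_of_matrix (v2r _) _ _).
  transitivity (\sum_j (@ofReal R ComplexScalars (r 0 (lshift n j)) *: e j +
    @ofReal R ComplexScalars (r 0 (rshift n j)) *:
      (imaginary_unit R ComplexScalars *: e j))).
    rewrite /real_comb big_split_ord big_split; congr (_ + _);
      apply: eq_bigr => j _.
      by rewrite /b (unsplitK (inl j)).
    by rewrite /b (unsplitK (inr j)).
  apply: eq_bigr => j _; rewrite scalerA -scalerDl.
  congr (_ *: _); apply/eqP; rewrite eq_complex/=.
  by rewrite !(mulr0, mulr1, mul0r, subr0, addr0, add0r) !eqxx.
have bK : cancel (real_comb b) co.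
  move=> r; apply/rowP => j; rewrite /co mxE.
  case: splitP => k kE; rewrite mxE v2rb/=.
    by congr (r _ _); apply/val_inj.
  by congr (r _ _); apply/val_inj.
exists (n + n), b, co; split => // v.
apply: (can_inj v2rK); apply/rowP => k; rewrite v2rb.
rewrite /co row_mxEl row_mxEr !mxE.
by case: (v2r v 0 k).
Qed.

Lemma scalar_coordinates (R : realType) (s : scalars)
  (V : lmodType (scalarField R s)) (n : nat) : has_dim V n ->
  exists (e : 'I_n -> V) (phi : 'I_n -> V -> (scalarField R s)^o),
    (forall i, linear (phi i)) /\ forall v, v = \sum_i phi i v *: e i.
Proof.
case=> f lf [r2v fK r2vK].
pose v2r : {linear V -> 'rV_n} := HB.pack f (GRing.isLinear.Build _ _ _ _ f lf).
exists (fun i => r2v (delta_mx 0 i)), (fun i v => v2r v 0 i); split.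
  by move=> i a u v; rewrite linearP !mxE.
move=> v; apply: (can_inj fK); rewrite -[f v]/(v2r v) -[f _]/(v2r _).
rewrite linear_sum [LHS]row_sum_delta; apply: eq_bigr => i _.
by rewrite linearZ; congr (_ *: _); rewrite [RHS]r2vK.
Qed.

Lemma ler_mx_entry (R : realType) (m : nat) (r : 'rV[R]_m) j : `|r 0 j| <= `|r|.
Proof.
rewrite [leRHS]/Num.norm /= mx_normrE; apply/bigmax_geP; right => /=.
by exists (0, j).
Qed.

Section CoordinatesNormed.
Variables (R : realType) (s : scalars) (W : normedModType (scalarField R s)).
Variables (m : nat) (b : 'I_m -> W) (coord : W -> 'rV[R]_m).
Hypothesis bK : cancel (real_comb b) coord.
Hypothesis coordK : cancel coord (real_comb b).

Lemma real_combB r t : real_comb b (r - t) = real_comb b r - real_comb b t.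
Proof.
rewrite /real_comb -sumrB; apply: eq_bigr => j _.
by rewrite !mxE ofRealD ofRealN scalerDl scaleNr.
Qed.

Lemma real_combZ (t : R) r : real_comb b (t *: r) = ofReal t *: real_comb b r.
Proof.
rewrite /real_comb scaler_sumr; apply: eq_bigr => j _.
by rewrite mxE ofRealM scalerA.
Qed.

Lemma rnorm_real_comb (r : 'rV[R]_m) :
  rnorm (real_comb b r) <= \sum_j `|r 0 j| * rnorm (b j).
Proof.
rewrite (le_trans (rnorm_sum _))//; apply: ler_sum => j _.
by rewrite rnormZ modulus_ofReal.
Qed.

Lemma continuous_rnorm_real_comb :
  continuous (fun r : 'rV[R]_m => rnorm (real_comb b r)).
Proof.
move=> r; apply/(@cvgrPdist_lt R R^o _ _ (nbhs_filter r)) => eps eps0.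
pose g (t : 'rV[R]_m) := \sum_j `|(t - r) 0 j| * rnorm (b j).
have gc : continuous g.
  apply: continuous_sum => j t.
  apply: (@cvgM _ _ (nbhs t) _ (fun u : 'rV[R]_m => `|(u - r) 0 j|)
    (fun=> rnorm (b j))); last exact: cvg_cst.
  apply: (@continuous_comp _ _ _ (fun t : 'rV[R]_m => (t - r) 0 j) Num.norm);
    last exact: norm_continuous.
  rewrite (_ : (fun t : 'rV[R]_m => _) = (fun t => t 0 j - r 0 j)).
    by apply: continuousB; [exact: coord_continuous|exact: cst_continuous].
  by apply/funext => u; rewrite !mxE.
have gr : g r = 0.
  by rewrite /g subrr big1// => j _; rewrite mxE normr0 mul0r.
have /(@cvgrPdist_lt R R^o _ _ (nbhs_filter r))/(_ _ eps0) := gc r.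
rewrite gr; apply: filterS => t.
rewrite sub0r normrN; apply: le_lt_trans.
apply: le_trans (ler_norm _).
rewrite ler_norml; apply/andP; split.
  rewrite lerBrDl lerBlDr.
  have := rnormD (real_comb b (t - r)) (real_comb b r).
  rewrite real_combB subrK => /le_trans; apply; rewrite addrC lerD2l.
  by rewrite -real_combB; exact: rnorm_real_comb.
rewrite lerBlDr.
have := rnormD (- real_comb b (t - r)) (real_comb b t).
rewrite rnormN real_combB opprB subrK => /le_trans; apply; rewrite lerD2r.
by rewrite -real_combB; exact: rnorm_real_comb.
Qed.

(** The nontrivial half of the equivalence of norms in finite dimension, by
    compactness of the unit sphere of coordinates. *)
Lemma coord_bounded :
  exists2 C, 0 < C & forall x j, `|coord x 0 j| <= C * rnorm x.
Proof.
pose S := [set r : 'rV[R]_m | `|r| = 1].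
have [S0|/set0P/negP/negPn/eqP S0] := pselect (S !=set0); last first.
  exists 1 => // x j; have [r0|/eqP r0] := pselect (coord x = 0).
    by rewrite r0 mxE normr0 mul1r rnorm_ge0.
  have : S (`|coord x|^-1 *: coord x).
    by rewrite /S/= normrZ normfV normr_id mulVf// normr_eq0.
  by rewrite S0.
have cS : compact S.
  apply: bounded_closed_compact.
    by exists 1; split => // M M1 r /= ->; exact: ltW.
  apply: (@preimage_closed _ _ (fun r : 'rV[R]_m => `|r|) [set 1]).
    by move=> w _; exact: norm_continuous.
  exact: closed_eq.
have [r0 Sr0 r0min] := compact_EVT_min S0 cS
  (continuous_subspaceT continuous_rnorm_real_comb).
rewrite inE in Sr0.
(* The norm of X is bounded below on the sphere S of the coordinates. *)
pose D := rnorm (real_comb b r0).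
have D0 : 0 < D.
  rewrite lt_neqAle rnorm_ge0 andbT eq_sym; apply/eqP => /rnorm0_eq0 D0.
  have := bK r0; rewrite D0 => r0E.
  have := bK 0; rewrite /real_comb big1 => [|j _]; last first.
    by rewrite mxE ofReal0 scale0r.
  rewrite r0E => r00; move: Sr0; rewrite /S/= r00 normr0 => /eqP.
  by rewrite eq_sym oner_eq0.
exists D^-1; first by rewrite invr_gt0.
move=> x j; rewrite mulrC ler_pdivlMr//.
apply: (@le_trans _ _ (`|coord x| * D)).
  by rewrite ler_pM2r// ler_mx_entry.
have [->|c0] := eqVneq (coord x) 0; first by rewrite normr0 mul0r rnorm_ge0.
have nc0 : 0 < `|coord x| by rewrite normr_gt0.
have /mem_set/r0min : S (`|coord x|^-1 *: coord x).
  by rewrite /S/= normrZ normfV normr_id mulVf// normr_eq0.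
rewrite real_combZ rnormZ modulus_ofReal_ge0; last first.
  by rewrite invr_ge0 ltW.
rewrite coordK.
by rewrite ler_pdivlMl.
Qed.

Lemma coord_linear (V : lmodType (scalarField R s)) (f : W -> V) x :
  linear f -> f x = \sum_j ofReal (coord x 0 j) *: f (b j).
Proof.
move=> lf; pose g : {linear W -> V} :=
  HB.pack f (GRing.isLinear.Build _ _ _ _ f lf).
rewrite -{1}(coordK x) -[f _]/(g _) linear_sum.
by apply: eq_bigr => j _; rewrite linearZ.
Qed.

Lemma coord_bounded_linear (V : normedModType (scalarField R s)) (f : W -> V) :
  linear f -> bounded_linear (@rnorm R s W) f.
Proof.
move=> lf; split => //.
have [C C0 bC] := coord_bounded.
exists (\sum_j C * rnorm (f (b j))) => x; rewrite (coord_linear x lf).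
apply: (le_trans (rnorm_sum _)); rewrite mulr_suml; apply: ler_sum => j _.
rewrite rnormZ modulus_ofReal mulrAC.
by apply: ler_wpM2r; [exact: rnorm_ge0|exact: bC].
Qed.

End CoordinatesNormed.

(** * Bounded operators and the joint numerical radius *)

Section BoundedOperators.
Variables (R : realType) (s : scalars) (V : lmodType (scalarField R s)).
Variables (N : V -> R) (W : normedModType (scalarField R s)).

Definition mk_bounded_op (f : V -> W) (fP : bounded_linear N f) :
  bounded_op N W := BoundedOp (introT (asboolP _) fP).

Lemma bounded_opP (f : bounded_op N W) : bounded_linear N f.
Proof. by case: f => f /= /asboolP. Qed.

Lemma bounded_op_linear (f : bounded_op N W) : linear f.
Proof. by case: (bounded_opP f). Qed.

Lemma bounded_opD (f : bounded_op N W) u v : f (u + v) = f u + f v.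
Proof. by have := bounded_op_linear f 1 u v; rewrite !scale1r. Qed.

Lemma bounded_op0 (f : bounded_op N W) : f 0 = 0.
Proof. by apply: (addrI (f 0)); rewrite -bounded_opD !addr0. Qed.

Lemma bounded_opZ (f : bounded_op N W) a v : f (a *: v) = a *: f v.
Proof. by rewrite -[a *: v]addr0 bounded_op_linear bounded_op0 addr0. Qed.

Lemma bounded_op_sum (I : finType) (f : bounded_op N W) (v : I -> V) :
  f (\sum_i v i) = \sum_i f (v i).
Proof. exact: (big_morph _ (bounded_opD f) (bounded_op0 f)). Qed.

Lemma bounded_op_ext (f g : bounded_op N W) : f =1 g -> f = g.
Proof. by move=> fg; apply: val_inj; apply/funext. Qed.

Hypothesis N0 : forall v, 0 <= N v.
Hypothesis NZ : forall a v, N (a *: v) = modulus a * N v.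

Lemma rnorm_le_opnorm (f : bounded_op N W) v :
  N v <= 1 -> rnorm (f v) <= opnorm f.
Proof.
move=> v1; apply: ub_le_sup; last by exists v.
have [_ [C fC]] := bounded_opP f.
exists `|C| => _ [u u1 <-]; rewrite (le_trans (fC u))//.
rewrite (@le_trans _ _ (`|C| * N u))//; first by rewrite ler_wpM2r ?ler_norm.
by rewrite ler_piMr.
Qed.

Lemma opnorm_le (f : bounded_op N W) (c : R) :
  0 <= c -> opnorm f <= c <-> forall v, rnorm (f v) <= c * N v.
Proof.
move=> c0; split=> [fc v|fc]; last first.
  apply: ge_sup.
    exists (rnorm (f 0)); exists 0 => //=.
    by have := NZ 0 0; rewrite scaler0 modulus0 mul0r /unit_ball/= => ->.
  move=> _ [v v1 <-]; rewrite (le_trans (fc v))//.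
  by rewrite ler_piMr.
have [v0|v0] := eqVneq (N v) 0.
  have [_ [C fC]] := bounded_opP f.
  by rewrite v0 mulr0 (le_trans (fC v))// v0 mulr0.
have {}v0 : 0 < N v by rewrite lt_neqAle eq_sym v0 N0.
have : rnorm (f (ofReal (N v)^-1 *: v)) <= c.
  apply: le_trans fc; apply: rnorm_le_opnorm.
  by rewrite NZ modulus_ofReal_ge0 ?invr_ge0// mulVf// gt_eqF.
rewrite bounded_opZ rnormZ modulus_ofReal_ge0 ?invr_ge0//.
by rewrite ler_pdivrMl// mulrC.
Qed.

Lemma opnorm_le1 (f : bounded_op N W) :
  opnorm f <= 1 <-> forall v, rnorm (f v) <= N v.
Proof.
by rewrite opnorm_le//; split=> H v; have := H v; rewrite mul1r.
Qed.

End BoundedOperators.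

Lemma dual_fun_sum (R : realType) (s : scalars)
  (V : lmodType (scalarField R s)) (N : V -> R) (I : finType)
  (g : I -> dual N) v :
  dual_fun (\sum_j g j) v = \sum_j dual_fun (g j) v.
Proof. exact: (big_morph (fun h : dual N => dual_fun h v)). Qed.

Lemma dual_ball_convex (R : realType) (s : scalars)
  (V : lmodType (scalarField R s)) (N : V -> R) (I : finType)
  (w : I -> R) (g : I -> dual N) :
  (forall v, 0 <= N v) -> (forall a v, N (a *: v) = modulus a * N v) ->
  (forall j, 0 <= w j) -> \sum_j w j = 1 ->
  (forall j, dual_norm N (g j) <= 1) ->
  unit_ball (dual_norm N) (\sum_j ofReal (w j) *: g j).
Proof.
move=> N0 NZ w0 w1 g1; apply/(opnorm_le1 N0 NZ) => v.
rewrite -[X in rnorm X]/(dual_fun _ v) dual_fun_sum.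
apply: le_trans (rnorm_sum _) _.
have -> : N v = \sum_j w j * N v by rewrite -mulr_suml w1 mul1r.
apply: ler_sum => j _.
rewrite [X in rnorm X](_ : _ = ofReal (w j) *:
  (dual_fun (g j) v : (scalarField R s)^o))//.
rewrite rnormZ modulus_ofReal_ge0// ler_wpM2l//.
exact: ((opnorm_le1 N0 NZ (g j)).1 (g1 j)).
Qed.

Section JointNumericalRadius.
Variables (R : realType) (s : scalars).
Variables (X : completeNormedModType (scalarField R s)).
Local Notation F := (scalarField R s).

Lemma Xnorm_ge0 (x : X) : 0 <= Xnorm X x.
Proof. exact: rnorm_ge0. Qed.

Lemma XnormZ a (x : X) :
  Xnorm X (a *: x) = modulus a * Xnorm X x.
Proof. exact: rnormZ. Qed.

Lemma Xball_convex (I : finType) (w : I -> R) (y : I -> X) :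
  (forall j, 0 <= w j) -> \sum_j w j = 1 -> (forall j, Xnorm X (y j) <= 1) ->
  unit_ball (Xnorm X) (\sum_j ofReal (w j) *: y j).
Proof.
move=> w0 w1 y1; apply: le_trans (rnorm_sum _) _; rewrite -[leRHS]w1.
apply: ler_sum => j _; rewrite rnormZ modulus_ofReal_ge0//.
by rewrite ler_piMr// y1.
Qed.

Lemma dual_norm_le1 (f : Xdual X) :
  dual_norm (Xnorm X) f <= 1 <-> forall x, modulus (dual_fun f x) <= Xnorm X x.
Proof. exact: (opnorm_le1 Xnorm_ge0 XnormZ). Qed.

(** Closed conditions suffice to describe Pi, since f(x) = 1 forces both norms
    up to 1. *)
Lemma state_pairsP (x : X) (f : Xdual X) :
  state_pairs X (x, f) <->
  [/\ Xnorm X x <= 1, dual_norm (Xnorm X) f <= 1 & dual_fun f x = 1].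
Proof.
split=> [[/= x1 f1 fx]|[x1 f1 fx]].
  by rewrite x1 f1.
split => //=; apply/eqP; rewrite eq_le.
  by rewrite x1/= -(modulus1 R s) -fx; move/dual_norm_le1: f1.
rewrite f1 /= -[leLHS](modulus1 R s) -fx.
exact: (rnorm_le_opnorm Xnorm_ge0).
Qed.

Lemma op_bounded (T : operators X) : exists2 C, 0 <= C &
  forall x, Xnorm X (op_fun T x) <= C * Xnorm X x.
Proof.
have [_ [C TC]] := bounded_opP T; exists `|C| => // x.
by rewrite (le_trans (TC x))// ler_wpM2r ?ler_norm ?Xnorm_ge0.
Qed.

Variables (d : nat) (p : R).
Hypothesis p0 : 0 < p.
Hypothesis Pi0 : state_pairs X !=set0.
Local Notation wp := (joint_num_radius X d p).
Local Notation Z := (operator_tuples X d).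

Lemma joint_num_radius_ub (T : Z) (x : X) (f : Xdual X) :
  state_pairs X (x, f) ->
  lp_norm p (fun i => dual_fun f (op_fun (tuple_nth T i) x)) <= wp T.
Proof.
move=> xf; apply: ub_le_sup; last by exists (x, f).
pose C i := sval (cid2 (op_bounded (tuple_nth T i))).
have C0 i : 0 <= C i by rewrite /C; case: cid2.
have TC i y : Xnorm X (op_fun (tuple_nth T i) y) <= C i * Xnorm X y.
  by rewrite /C; case: cid2.
exists (lp_norm p (fun i => ofReal (C i) : F)) => _ [[y g] [/= y1 g1 _] <-].
apply: lp_norm_le => // i; rewrite modulus_ofReal_ge0//.
have g1' : dual_norm (Xnorm X) g <= 1 by rewrite g1.
move/dual_norm_le1: g1' => /(_ (op_fun (tuple_nth T i) y)) /le_trans; apply.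
by rewrite (le_trans (TC i y))// y1 mulr1.
Qed.

Lemma joint_num_radius_le (T : Z) (M : R) :
  (forall (x : X) (f : Xdual X), state_pairs X (x, f) ->
    lp_norm p (fun i => dual_fun f (op_fun (tuple_nth T i) x)) <= M) ->
  wp T <= M.
Proof.
move=> TM; apply: ge_sup.
  by case: Pi0 => u uP; eexists; exists u.
by move=> _ [[x f] xf <-]; exact: TM.
Qed.

Lemma joint_num_radius_ge0 (T : Z) : 0 <= wp T.
Proof.
case: Pi0 => -[x f] xf.
by apply: le_trans (joint_num_radius_ub T xf); exact: lp_norm_ge0.
Qed.

Lemma joint_num_radiusZ a (T : Z) : wp (a *: T) = modulus a * wp T.
Proof.
have fZ b (S : Z) x (f : Xdual X) :
    lp_norm p (fun i => dual_fun f (op_fun (tuple_nth (b *: S) i) x)) =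
    modulus b * lp_norm p (fun i => dual_fun f (op_fun (tuple_nth S i) x)).
  rewrite (_ : (fun i => _) =
    (fun i => b * dual_fun f (op_fun (tuple_nth S i) x))).
    by rewrite lp_normZ// gt_eqF.
  by apply/funext => i; rewrite -[RHS]bounded_opZ /tuple_nth ffunE.
have le b (S : Z) : wp (b *: S) <= modulus b * wp S.
  apply: joint_num_radius_le => x f xf; rewrite fZ.
  by rewrite ler_wpM2l ?modulus_ge0// joint_num_radius_ub.
apply/eqP; rewrite eq_le le/=.
have [->|a0] := eqVneq a 0.
  by rewrite modulus0 mul0r joint_num_radius_ge0.
have ma0 : 0 < modulus a.
  rewrite lt_neqAle modulus_ge0 andbT eq_sym.
  by apply: contra a0 => /eqP/modulus_eq0->.
rewrite -ler_pdivlMl//; have := le a^-1 (a *: T).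
rewrite scalerA mulVf// scale1r => /le_trans; apply.
rewrite le_eqVlt; apply/orP; left; apply/eqP; congr (_ * _).
apply: (mulIf (lt0r_neq0 ma0)).
by rewrite -modulusM mulVf// modulus1 mulVf// gt_eqF.
Qed.

Lemma Zdual_norm_le1 (phi : Zdual X d p) :
  Zdual_norm X d p phi <= 1 <-> forall T, modulus (Zdual_fun phi T) <= wp T.
Proof. exact: (opnorm_le1 joint_num_radius_ge0 joint_num_radiusZ). Qed.

End JointNumericalRadius.

(** * Extreme points and convex combinations *)

(** A combination with weight w_j in (0, 1) is a segment from y_j to the
    renormalized combination of the other points. *)
Lemma extreme_point_combination (R : realType) (s : scalars)
  (V : lmodType (scalarField R s)) (A : set V) (I : finType)
  (w : I -> R) (y : I -> V) (v : V) :
  (forall w' : I -> R, (forall j, 0 <= w' j) -> \sum_j w' j = 1 ->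
     A (\sum_j ofReal (w' j) *: y j)) ->
  (forall j, A (y j)) -> extreme_points A v ->
  (forall j, 0 <= w j) -> \sum_j w j = 1 -> v = \sum_j ofReal (w j) *: y j ->
  forall j, 0 < w j -> y j = v.
Proof.
move=> Aconv Ay [_ vext] w0 w1 vE j wj0.
have [wj1|wj1] := eqVneq (w j) 1.
  have wN i : i != j -> w i = 0.
    move: w1; rewrite (bigD1 j)//= wj1 => /(canRL (addKr _)).
    rewrite addNr => /psumr_eq0P H ij.
    exact: H.
  rewrite vE (bigD1 j)//= big1 => [|i ij]; last by rewrite wN// ofReal0 scale0r.
  by rewrite wj1 ofReal1 scale1r addr0.
have wjlt1 : w j < 1.
  rewrite lt_neqAle wj1 -w1 (bigD1 j)//= lerDl; exact: sumr_ge0.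
pose w' i := if i == j then 0 else w i / (1 - w j).
have w'1 : \sum_i w' i = 1.
  rewrite (bigD1 j)//= {1}/w' eqxx add0r.
  rewrite (eq_bigr (fun i => w i / (1 - w j))) => [|i ij]; last first.
    by rewrite /w' (negbTE ij).
  have S1 : \sum_(i | i != j) w i = 1 - w j.
    by have := w1; rewrite (bigD1 j)//= => <-; rewrite addrC addrK.
  by rewrite -mulr_suml S1 divff// subr_eq0 eq_sym.
have w'0 i : 0 <= w' i.
  by rewrite /w'; case: ifP => // _; rewrite divr_ge0// subr_ge0 ltW.
have [] // := vext (y j) (\sum_i ofReal (w' i) *: y i) (w j).
- exact: Aconv.
- by rewrite wj0.
rewrite vE (bigD1 j)//=; congr (_ + _).
rewrite scaler_sumr [RHS](bigD1 j)//= {1}/w' eqxx ofReal0 scale0r scaler0 add0r.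
apply: eq_bigr => i ij; rewrite scalerA -ofRealM /w' (negbTE ij).
by rewrite mulrC divfK// subr_eq0 eq_sym.
Qed.

Lemma weighted_sum_eq1 (R : realType) (I : finType) (w y : I -> R) :
  (forall j, 0 <= w j) -> \sum_j w j = 1 -> (forall j, 0 < w j -> y j <= 1) ->
  \sum_j w j * y j = 1 -> forall j, 0 < w j -> y j = 1.
Proof.
move=> w0 w1 y1 wy j wj.
have H i : 0 <= w i * (1 - y i).
  have [->|wi] := eqVneq (w i) 0; first by rewrite mul0r.
  by rewrite mulr_ge0// subr_ge0 y1// lt_neqAle eq_sym wi w0.
have S0 : \sum_i w i * (1 - y i) = 0.
  under eq_bigr do rewrite mulrBr mulr1.
  by rewrite sumrB w1 wy subrr.
have /eqP := @psumr_eq0P _ _ xpredT _ (fun i _ => H i) S0 j isT.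
by rewrite mulf_eq0 gt_eqF//= subr_eq0 => /eqP.
Qed.

Lemma midpoint_bounds (R : realType) (r : R) :
  0 <= r -> r < 1 -> 0 < (1 + r) / 2 < 1.
Proof. by move=> r0 r1; apply/andP; split; lra. Qed.

(** * The unit ball of the dual of Z as a convex hull *)

Section TensorFunctionals.
Variables (R : realType) (s : scalars).
Variables (X : completeNormedModType (scalarField R s)).
Variables (d : nat) (p q : R).
Hypotheses (p0 : 0 < p) (q0 : 0 < q) (pq : p^-1 + q^-1 = 1).
Hypothesis Pi0 : state_pairs X !=set0.
Local Notation F := (scalarField R s).
Local Notation wp := (joint_num_radius X d p).
Local Notation Z := (operator_tuples X d).

Lemma tensor_functional_linear (a : 'I_d -> F) (f : Xdual X) (x : X) :
  linear (tensor_functional a f x : Z -> F^o).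
Proof.
move=> c S T; rewrite /tensor_functional scaler_sumr -big_split/=.
apply: eq_bigr => i _.
have -> : op_fun (tuple_nth (c *: S + T) i) x =
    c *: op_fun (tuple_nth S i) x + op_fun (tuple_nth T i) x.
  by rewrite /tuple_nth !ffunE.
have -> : dual_fun f (c *: op_fun (tuple_nth S i) x + op_fun (tuple_nth T i) x)
    = c * dual_fun f (op_fun (tuple_nth S i) x)
      + dual_fun f (op_fun (tuple_nth T i) x) by exact: bounded_op_linear.
by rewrite mulrDr mulrCA.
Qed.

Lemma tensor_functional_le (a : 'I_d -> F) (f : Xdual X) (x : X) (T : Z) :
  state_pairs X (x, f) ->
  modulus (tensor_functional a f x T) <= lp_norm q a * wp T.
Proof.
move=> xf; apply: le_trans (hoelder_lp_norm p0 q0 pq _ _) _.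
by rewrite ler_wpM2l ?lp_norm_ge0// joint_num_radius_ub.
Qed.

Lemma tensor_functional_bounded (a : 'I_d -> F) (f : Xdual X) (x : X) :
  state_pairs X (x, f) ->
  @bounded_linear R s Z wp F^o (tensor_functional a f x).
Proof.
move=> xf; split; first exact: tensor_functional_linear.
by exists (lp_norm q a) => T; exact: tensor_functional_le.
Qed.

Definition tensor (a : 'I_d -> F) (f : Xdual X) (x : X)
  (xf : state_pairs X (x, f)) : Zdual X d p :=
  mk_bounded_op (tensor_functional_bounded a xf).

Lemma tensor_in_ball (a : 'I_d -> F) (f : Xdual X) (x : X)
  (xf : state_pairs X (x, f)) :
  lp_norm q a <= 1 -> Zdual_norm X d p (tensor a xf) <= 1.
Proof.
move=> a1; apply/(Zdual_norm_le1 p0 Pi0) => T.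
apply: le_trans (tensor_functional_le a T xf) _.
by rewrite ler_piMl// joint_num_radius_ge0.
Qed.

Variables (m : nat) (b : 'I_m -> X) (coord : X -> 'rV[R]_m).
Hypothesis bK : cancel (real_comb b) coord.
Hypothesis coordK : cancel coord (real_comb b).
Variables (n : nat) (e : 'I_n -> X) (phi : 'I_n -> X -> F^o).
Hypothesis phi_linear : forall i, linear (phi i).
Hypothesis phiE : forall v, v = \sum_i phi i v *: e i.

Lemma scalar_coordinates_inj (x y : X) :
  (forall l, phi l x = phi l y) -> x = y.
Proof.
move=> xy; rewrite (phiE x) (phiE y); apply: eq_bigr => l _.
by rewrite xy.
Qed.

Lemma rank_one_linear (g : X -> F^o) (u : X) :
  linear g -> linear (fun x => (g x : F) *: u).
Proof. by move=> lg a x y; rewrite lg scalerDl scalerA. Qed.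

Definition rank_one (g : X -> F^o) (lg : linear g) (u : X) : operators X :=
  @mk_bounded_op R s X (Xnorm X) X _
    (coord_bounded_linear bK coordK (rank_one_linear u lg)).

Lemma rank_one_dual (f : Xdual X) (g : X -> F^o) (lg : linear g) (u x : X) :
  dual_fun f (op_fun (rank_one lg u) x) = g x * dual_fun f u.
Proof. exact: (bounded_opZ f). Qed.

Lemma id_linear : linear (@id X). Proof. by []. Qed.

Definition id_operator : operators X :=
  mk_bounded_op (coord_bounded_linear bK coordK id_linear).

Definition slot (i : 'I_d) (S : operators X) : Z :=
  [ffun l => if l == i then S else 0].

Lemma tensor_functional_slot a (f : Xdual X) x i (S : operators X) :
  tensor_functional a f x (slot i S) = a i * dual_fun f (op_fun S x).
Proof.
rewrite /tensor_functional (bigD1 i)//= big1 => [|l li].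
  by rewrite /tuple_nth ffunE eqxx addr0.
rewrite /tuple_nth ffunE (negbTE li).
have -> : op_fun (0 : operators X) x = 0 by [].
by rewrite [dual_fun f 0]bounded_op0 mulr0.
Qed.

Lemma combination_linear (c : 'I_n -> F) :
  linear ((fun x => \sum_l c l * phi l x) : X -> F^o).
Proof.
move=> a x y; rewrite scaler_sumr -big_split; apply: eq_bigr => l _.
by rewrite phi_linear mulrDr mulrCA.
Qed.

Definition combination (c : 'I_n -> F) : Xdual X :=
  @mk_bounded_op R s X (Xnorm X) F^o _
    (coord_bounded_linear bK coordK (combination_linear c)).

Lemma combinationE (f : Xdual X) : f = combination (fun l => dual_fun f (e l)).
Proof.
apply: bounded_op_ext => x /=; rewrite {1}(phiE x) bounded_op_sum.
by apply: eq_bigr => l _; rewrite bounded_opZ mulrC.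
Qed.

(** These tuples span Z over the reals, the range of each operator being taken
    in the real basis; so the real parts of its values on them determine a
    functional. *)
Definition test_tuple (k : 'I_d * ('I_n * 'I_m)) : Z :=
  [ffun l => if l == k.1 then rank_one (phi_linear k.2.1) (b k.2.2) else 0].

Lemma test_tuple_span (T : Z) :
  T = \sum_k ofReal (coord (op_fun (tuple_nth T k.1) (e k.2.1)) 0 k.2.2)
      *: test_tuple k.
Proof.
apply/ffunP => l; apply: bounded_op_ext => x.
pose ev (S : Z) : X := op_fun (tuple_nth S l) x.
rewrite -[LHS]/(ev T) -[RHS]/(ev _).
have ev0 : ev 0 = 0 by rewrite /ev /tuple_nth ffunE.
have evD : {morph ev : S S' / S + S'}.
  by move=> S S'; rewrite /ev /tuple_nth ffunE.
have evZ c S : ev (c *: S) = c *: ev S by rewrite /ev /tuple_nth ffunE.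
rewrite (big_morph ev evD ev0).
rewrite -(pair_bigA _ (fun l' k => ev (ofReal (coord
  (op_fun (tuple_nth T l') (e k.1)) 0 k.2) *: test_tuple (l', k)))).
rewrite (bigD1 l)//= [X in _ + X]big1 ?addr0 => [|l' l'l]; last first.
  apply: big1 => k _.
  by rewrite evZ /ev /tuple_nth ffunE/= eq_sym (negbTE l'l) scaler0.
rewrite -(pair_bigA _ (fun i j => ev (ofReal (coord
  (op_fun (tuple_nth T l) (e i)) 0 j) *: test_tuple (l, (i, j))))).
rewrite {1}/ev {1}(phiE x) [op_fun _ _]bounded_op_sum; apply: eq_bigr => i _.
rewrite bounded_opZ -[X in _ *: X]coordK scaler_sumr; apply: eq_bigr => j _.
by rewrite evZ /ev /tuple_nth ffunE/= eqxx !scalerA mulrC.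
Qed.

Lemma test_tuple_separation (f g : Z -> F^o) : linear f -> linear g ->
  (forall k, toReal (f (test_tuple k)) = toReal (g (test_tuple k))) ->
  f =1 g.
Proof.
move=> lf lg fg T.
pose fL : {linear Z -> F^o} := HB.pack f (GRing.isLinear.Build _ _ _ _ f lf).
pose gL : {linear Z -> F^o} := HB.pack g (GRing.isLinear.Build _ _ _ _ g lg).
have re S : toReal (fL S) = toReal (gL S).
  rewrite (test_tuple_span S) !linear_sum !toReal_sum; apply: eq_bigr => k _.
  by rewrite !linearZ !toReal_ofRealM; congr (_ * _); exact: fg.
rewrite -[f T]/(fL T) -[g T]/(gL T).
rewrite [LHS]scalar_decomposition [RHS]scalar_decomposition re.
rewrite -[imaginary_unit R s * fL T]linearZ.
by rewrite -[imaginary_unit R s * gL T]linearZ re.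
Qed.

Local Notation index := ('I_d * ('I_n * 'I_m))%type.

Definition tensor_point (a : 'I_d -> F) (f : Xdual X) (x : X) :
  'rV[R]_#|{: index}| :=
  \row_k toReal (tensor_functional a f x (test_tuple (enum_val k))).

Definition tensor_points : set 'rV[R]_#|{: index}| :=
  [set v | exists a f x,
     [/\ lp_norm q a <= 1, state_pairs X (x, f) & v = tensor_point a f x]].

(** The data (a, f, x) range, through their codes, over a closed subset of a
    box, on which the values at the test tuples are polynomial. *)
Lemma compact_tensor_points : compact tensor_points.
Proof.
pose T := (('rV[R]_d * 'rV[R]_d) * (('rV[R]_n * 'rV[R]_n) * 'rV[R]_m))%type.
pose A (t : T) : 'I_d -> F := decode_row s t.1.
pose C (t : T) : 'I_n -> F := decode_row s t.2.1.
pose r (t : T) : 'rV[R]_m := t.2.2.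
have fstc (U V : topologicalType) : continuous (@fst U V).
  by move=> z; exact: cvg_fst.
have sndc (U V : topologicalType) : continuous (@snd U V).
  by move=> z; exact: cvg_snd.
have Ac i : scalar_continuous (fun t : T => A t i).
  apply: (@scalar_continuous_comp R s _ _ (fun t : T => t.1)
    (fun z => decode_row s z i)); first exact: fstc.
  exact: scalar_continuous_decode_row.
have Cc i : scalar_continuous (fun t : T => C t i).
  apply: (@scalar_continuous_comp R s _ _ (fun t : T => t.2.1)
    (fun z => decode_row s z i)); last exact: scalar_continuous_decode_row.
  move=> t.
  by apply: (@continuous_comp _ _ _ snd fst); [exact: sndc|exact: fstc].
have rcont : continuous r.
  by move=> t; apply: (@continuous_comp _ _ _ snd snd); exact: sndc.
have rc j : continuous (fun t : T => r t 0 j).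
  move=> t; apply: (@continuous_comp _ _ _ r (fun w : 'rV[R]_m => w 0 j)).
    exact: rcont.
  exact: coord_continuous.
have fc (x : X) : scalar_continuous (fun t : T =>
    dual_fun (combination (C t)) x).
  apply: scalar_continuous_sum => l; apply: scalar_continuousM; first exact: Cc.
  exact: scalar_continuous_cst.
have fxc (S : operators X) : scalar_continuous (fun t : T =>
    dual_fun (combination (C t)) (op_fun S (real_comb b (r t)))).
  rewrite (_ : (fun t : T => _) = (fun t => \sum_j ofReal (r t 0 j) *
      dual_fun (combination (C t)) (op_fun S (b j)))).
    apply: scalar_continuous_sum => j; apply: scalar_continuousM => //.
    exact: scalar_continuous_ofReal.
  apply/funext => t; rewrite /real_comb [op_fun _ _]bounded_op_sum.
  rewrite [LHS]bounded_op_sum; apply: eq_bigr => j _.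
  by rewrite !bounded_opZ.
have [c0 c0_gt0 c0P] := coord_bounded bK coordK.
pose Br := [set w : 'rV[R]_m | forall j, `[- c0, c0]%classic (w ord0 j)].
(* Bounds for the codes: the coordinates of f are its values at the e_l. *)
pose M := \sum_l Xnorm X (e l).
pose Box : set T := code_box 1 `*` (code_box M `*` Br).
have cBox : compact Box.
  apply: compact_setX; first exact: compact_code_box.
  by apply: compact_setX; [exact: compact_code_box|exact: compact_cube].
(* The conditions on the data (a, f, x), read on their codes: a is in the
   ball of l_q, f in that of the dual, x in that of X, and Re f(x) >= 1,
   which then forces f(x) = 1. *)
pose G1 : set T := [set t | forall c : 'I_d -> F,
  toReal (\sum_i A t i * c i) <= lp_norm p c].
pose G2 : set T := [set t | forall x : X,
  toReal (dual_fun (combination (C t)) x) <= Xnorm X x].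
pose G3 : set T := [set t | rnorm (real_comb b (r t)) <= 1].
pose G4 : set T := [set t |
  1 - toReal (dual_fun (combination (C t)) (real_comb b (r t))) <= 0].
pose D := Box `&` G1 `&` G2 `&` G3 `&` G4.
have cD : compact D.
  apply: compact_closedI; last first.
    apply: closed_sublevel; apply: continuous_subr.
      exact: cst_continuous.
    by case: (fxc (mk_bounded_op (coord_bounded_linear bK coordK
      ((fun _ _ _ => erefl) : linear (@id X))))).
  apply: compact_closedI; last first.
    apply: closed_sublevel => t.
    apply: (@continuous_comp _ _ _ r (fun w => rnorm (real_comb b w))).
      exact: rcont.
    exact: continuous_rnorm_real_comb.
  apply: compact_closedI; last first.
    by apply: closed_forall_le => x; case: (fc x).
  apply: compact_closedI => //.
  apply: closed_forall_le => c.
  have [] : scalar_continuous (fun t : T => \sum_i A t i * c i) => //.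
  apply: scalar_continuous_sum => i; apply: scalar_continuousM => //.
  exact: scalar_continuous_cst.
pose h (t : T) := tensor_point (A t) (combination (C t)) (real_comb b (r t)).
have -> : tensor_points = h @` D.
  apply/seteqP; split=> v.
    move=> [a [f [x [a1 /[dup] xf /state_pairsP[x1 f1 fx] ->]]]].
    pose t : T := (encode_row a,
      (encode_row (fun l => dual_fun f (e l)), coord x)).
    have At : A t = a by apply/funext => i; exact: encode_rowK.
    have Ct : combination (C t) = f.
      rewrite [RHS]combinationE; congr combination; apply/funext => l.
      exact: encode_rowK.
    have rt : real_comb b (r t) = x by exact: coordK.
    exists t; last by rewrite /h At Ct rt.
    have f1' := (dual_norm_le1 f).1 f1.
    split; [split; [split; [split|]|]|].
    - split.
        by apply: code_box_encode => i; exact: (lp_ball_modulus i q0 a1).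
      split=> /=.
        apply: code_box_encode => l; apply: le_trans (f1' _) _.
        by rewrite /M (bigD1 l)//= lerDl sumr_ge0// => l' _; exact: Xnorm_ge0.
      move=> j; rewrite /= in_itv/= -ler_norml (le_trans (c0P _ _))//.
      by rewrite ler_piMr// ltW.
    - by move=> c; rewrite At; apply: (lp_ballP a p0 q0 pq).1.
    - by move=> y; rewrite Ct (le_trans _ (f1' y))// ler_toReal_modulus.
    - by rewrite /G3 /mkset rt.
    - by rewrite /G4 /mkset Ct rt fx toReal1 subrr.
  move=> [t [[[[_ G1t] G2t] G3t] G4t] <-].
  exists (A t), (combination (C t)), (real_comb b (r t)).
  have f1 : dual_norm (Xnorm X) (combination (C t)) <= 1.
    apply/dual_norm_le1; apply: toReal_bound_modulus => //.
    - exact: combination_linear.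
    - by move=> c x c1; rewrite XnormZ c1 mul1r.
  split; [exact/(lp_ballP _ p0 q0 pq)| |by []].
  apply/state_pairsP; split; [exact: G3t|exact: f1|].
  apply: scalar_eq1; last by have := G4t; rewrite /G4 /mkset subr_le0.
  by apply: le_trans ((dual_norm_le1 _).1 f1 _) _; exact: G3t.
apply: continuous_compact => //; apply: continuous_subspaceT.
apply: continuous_rowP => j; rewrite /h /tensor_point.
under eq_fun do rewrite mxE.
have [] : scalar_continuous (fun t : T => tensor_functional (A t)
   (combination (C t)) (real_comb b (r t)) (test_tuple (enum_val j))) => //.
apply: scalar_continuous_sum => i; apply: scalar_continuousM => //.
Qed.

Lemma sum_toReal_test (L : Z -> F^o) (l : 'rV[R]_#|{: index}|) : linear L ->
  \sum_k l 0 k * toReal (L (test_tuple (enum_val k))) =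
  toReal (L (\sum_k ofReal (l 0 k) *: test_tuple (enum_val k))).
Proof.
move=> lL.
pose LL : {linear Z -> F^o} := HB.pack L (GRing.isLinear.Build _ _ _ _ L lL).
rewrite -[L (\sum_k _)]/(LL _) linear_sum toReal_sum; apply: eq_bigr => k _.
by rewrite linearZ [RHS]toReal_ofRealM.
Qed.

(** A real linear form l on the coordinates is evaluation at the tuple
    T = sum_k l_k T_k, and Re psi(T) <= w_p(T), which is the largest value of
    Re k(T) on K: each pair in Pi contributes through a vector norming
    (f(T_i x))_i. *)
Lemma tensor_points_support (psi : Zdual X d p) (l : 'rV[R]_#|{: index}|) :
  Zdual_norm X d p psi <= 1 ->
  exists2 v, tensor_points v &
    \sum_k l 0 k * toReal (Zdual_fun psi (test_tuple (enum_val k)))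
      <= \sum_k l 0 k * v 0 k.
Proof.
move=> /(Zdual_norm_le1 p0 Pi0) psi1.
have [v vK vmax] : exists2 v, tensor_points v & forall u, tensor_points u ->
    \sum_k l 0 k * u 0 k <= \sum_k l 0 k * v 0 k.
  have K0 : tensor_points !=set0.
    case: Pi0 => -[x f] xf.
    have [a a1 _] := hoelder_norming p0 q0 pq (fun _ : 'I_d => 0 : F).
    by exists (tensor_point a f x); exists a, f, x.
  have lc : continuous (fun u : 'rV[R]_#|{: index}| => \sum_k l 0 k * u 0 k).
    apply: continuous_sum => k; apply: continuous_mulr.
      exact: cst_continuous.
    exact: coord_continuous.
  have [v vK vmax] := compact_EVT_max K0 compact_tensor_points
    (continuous_subspaceT lc).
  rewrite inE in vK; exists v => // u uK.
  by apply: vmax; rewrite inE.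
exists v => //; rewrite (sum_toReal_test _ (bounded_op_linear psi)).
apply: le_trans (ler_toReal_modulus _) _.
apply: le_trans (psi1 _) _.
apply: (joint_num_radius_le Pi0) => x f xf.
set T := \sum_k _; set c := (fun i : 'I_d => _).
have [a a1 ac] := hoelder_norming p0 q0 pq c.
rewrite -(toReal_ofReal s (lp_norm p c)) -ac.
rewrite -[X in toReal X]/(tensor_functional a f x T).
rewrite -(sum_toReal_test _ (tensor_functional_linear a f x)).
have aK : tensor_points (tensor_point a f x) by exists a, f, x.
rewrite (le_trans _ (vmax _ aK))// le_eqVlt; apply/orP; left; apply/eqP.
by apply: eq_bigr => k _; rewrite mxE.
Qed.

Lemma Zdual_ball_hull (psi : Zdual X d p) : Zdual_norm X d p psi <= 1 ->
  exists (k : nat) (w : 'I_k -> R) (a : 'I_k -> 'I_d -> F) (f : 'I_k -> Xdual X)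
    (x : 'I_k -> X),
  [/\ forall j, 0 <= w j, \sum_j w j = 1, forall j, lp_norm q (a j) <= 1,
      forall j, state_pairs X (x j, f j)
    & forall T, Zdual_fun psi T =
        \sum_j ofReal (w j) * tensor_functional (a j) (f j) (x j) T].
Proof.
move=> psi1.
pose v : 'rV[R]_#|{: index}| :=
  \row_k toReal (Zdual_fun psi (test_tuple (enum_val k))).
have vsup (l : 'rV[R]_#|{: index}|) : exists2 u, tensor_points u &
    \sum_k l 0 k * v 0 k <= \sum_k l 0 k * u 0 k.
  have [u uK lu] := tensor_points_support l psi1; exists u => //.
  by under eq_bigr do rewrite mxE.
have K0 : tensor_points !=set0 by have [u uK _] := vsup 0; exists u.
have [k [w [u [w0 w1 uK vE]]]] :=
  mem_convex_hull_of_support compact_tensor_points K0 vsup.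
have /choice[g gP] : forall j, exists y : ('I_d -> F) * Xdual X * X,
    [/\ lp_norm q y.1.1 <= 1, state_pairs X (y.2, y.1.2)
      & u j = tensor_point y.1.1 y.1.2 y.2].
  by move=> j; have [a [f [x axf]]] := uK j; exists (a, f, x).
exists k, w, (fun j => (g j).1.1), (fun j => (g j).1.2), (fun j => (g j).2).
split => //; try by move=> j; case: (gP j).
apply: test_tuple_separation.
- exact: (bounded_op_linear psi).
- move=> c S T; rewrite scaler_sumr -big_split; apply: eq_bigr => j _.
  rewrite [tensor_functional _ _ _ _]tensor_functional_linear mulrDr.
  by rewrite [_ *: (_ * _)]mulrCA.
- move=> i; rewrite toReal_sum -(enum_rankK i).
  have := congr1 (fun M : 'rV[R]_#|{: index}| => M 0 (enum_rank i)) vE.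
  rewrite mxE => ->; rewrite summxE; apply: eq_bigr => j _.
  by rewrite mxE toReal_ofRealM; case: (gP j) => _ _ ->; rewrite mxE.
Qed.

(** * The extreme points of the unit ball of the dual of Z *)

(** Extremality of a, f and x is used separately, on three families of test
    tuples: multiples of the identity, operators with range spanned by x, and
    operators y |-> f(y) u. *)
Lemma extreme_tensor_combination (I : finType) (w : I -> R)
  (a : 'I_d -> F) (f : Xdual X) (x : X)
  (aj : I -> 'I_d -> F) (fj : I -> Xdual X) (xj : I -> X) :
  lp_norm q a = 1 -> ball_extreme_points (dual_norm (Xnorm X)) f ->
  ball_extreme_points (Xnorm X) x -> dual_fun f x = 1 ->
  (forall j, 0 <= w j) -> \sum_j w j = 1 ->
  (forall j, lp_norm q (aj j) <= 1) -> (forall j, state_pairs X (xj j, fj j)) ->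
  (forall T : Z, tensor_functional a f x T =
     \sum_j ofReal (w j) * tensor_functional (aj j) (fj j) (xj j) T) ->
  forall j, 0 < w j -> forall T : Z,
    tensor_functional (aj j) (fj j) (xj j) T = tensor_functional a f x T.
Proof.
move=> a1 fext xext fx w0 w1 aj1 xfj comb.
have xj1 j : Xnorm X (xj j) <= 1 by have /state_pairsP[] := xfj j.
have fj1 j : dual_norm (Xnorm X) (fj j) <= 1 by have /state_pairsP[] := xfj j.
have fjle j y : modulus (dual_fun (fj j) y) <= Xnorm X y.
  exact: ((dual_norm_le1 _).1 (fj1 j)).
have fjxj j : dual_fun (fj j) (xj j) = 1 by have /state_pairsP[] := xfj j.
have fle y : modulus (dual_fun f y) <= Xnorm X y.
  by apply: (dual_norm_le1 f).1; case: fext.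
(* T = c Id in one slot recovers a as the same combination of the a_j;
   a functional norming a then norms every a_j of positive weight. *)
have ajE j : 0 < w j -> forall i, aj j i = a i.
  move=> wj.
  have aE i : a i = \sum_j ofReal (w j) * aj j i.
    have := comb (slot i id_operator).
    rewrite tensor_functional_slot fx mulr1 => ->.
    by apply: eq_bigr => j' _; rewrite tensor_functional_slot fjxj mulr1.
  have qp : q^-1 + p^-1 = 1 by rewrite addrC.
  have [c c1 ca] := hoelder_norming q0 p0 qp a.
  have ac : toReal (\sum_i a i * c i) = 1.
    by under eq_bigr do rewrite mulrC; rewrite ca toReal_ofReal a1.
  have ajc : \sum_j w j * toReal (\sum_i aj j i * c i) = 1.
    rewrite -ac; under [in RHS]eq_bigr do rewrite aE mulr_suml.
    rewrite exchange_big/= toReal_sum; apply: eq_bigr => j' _.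
    rewrite -toReal_ofRealM mulr_sumr; congr toReal.
    by apply: eq_bigr => i _; rewrite mulrA.
  have ajcj : toReal (\sum_i aj j i * c i) = 1.
    apply: (weighted_sum_eq1 w0 w1 _ ajc wj) => j' _.
    apply: le_trans (ler_toReal_modulus _) _.
    apply: le_trans (hoelder_lp_norm p0 q0 pq _ _) _.
    have := ler_pM (lp_norm_ge0 q (aj j')) (lp_norm_ge0 p c) (aj1 j') c1.
    by rewrite mulr1.
  apply: (hoelder_eq p0 q0 pq (aj1 j) _ c1 ajcj ac).
  by rewrite a1.
have [i0 ai0] : exists i, a i != 0.
  by apply: (lp_norm_neq0 (p := q)); rewrite ?(gt_eqF q0)// a1 oner_eq0.
(* Once the coefficients agree they cancel. *)
have combS (S : operators X) : dual_fun f (op_fun S x) =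
    \sum_j ofReal (w j) * dual_fun (fj j) (op_fun S (xj j)).
  apply: (mulfI ai0); have := comb (slot i0 S).
  rewrite tensor_functional_slot => ->; rewrite mulr_sumr.
  apply: eq_bigr => j _; rewrite tensor_functional_slot.
  have [->|wj] := eqVneq (w j) 0; first by rewrite ofReal0 !mul0r mulr0.
  by rewrite mulrCA ajE// lt_neqAle eq_sym wj w0.
have dZ (h : Xdual X) c (y : X) : dual_fun h (c *: y) = c * dual_fun h y.
  exact: bounded_opZ.
(* S y = g(y) x, for g a coordinate, gives x = sum_j w_j f_j(x) x_j. *)
have xE : forall j, 0 < w j -> dual_fun (fj j) x *: xj j = x.
  apply: (@extreme_point_combination R s X (unit_ball (Xnorm X)) I w
    (fun j => dual_fun (fj j) x *: xj j) x _ _ xext w0 w1).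
  - move=> w' w'0 w'1; apply: Xball_convex => // i.
    rewrite XnormZ mulr_ile1 ?modulus_ge0 ?Xnorm_ge0//.
    by rewrite (le_trans (fjle i x))//; case: xext.
  - move=> i; rewrite /unit_ball/= XnormZ mulr_ile1 ?modulus_ge0 ?Xnorm_ge0//.
    by rewrite (le_trans (fjle i x))//; case: xext.
  apply: scalar_coordinates_inj => l.
  have := combS (rank_one (phi_linear l) x).
  rewrite dZ fx mulr1 => ->.
  pose pl : {linear X -> F^o} :=
    HB.pack (phi l) (GRing.isLinear.Build _ _ _ _ (phi l) (phi_linear l)).
  rewrite -[RHS]/(pl _) linear_sum; apply: eq_bigr => i _.
  by rewrite !linearZ dZ; congr (_ * _); rewrite mulrC.
(* S y = f(y) u gives f = sum_j w_j f(x_j) f_j. *)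
have ffj : forall j, 0 < w j -> dual_fun f (xj j) *: fj j = f.
  apply: (@extreme_point_combination R s (Xdual X)
    (unit_ball (dual_norm (Xnorm X))) I w
    (fun j => dual_fun f (xj j) *: fj j) f _ _ fext w0 w1).
  - move=> w' w'0 w'1.
    apply: (dual_ball_convex (@Xnorm_ge0 R s X) (@XnormZ R s X)) => // i.
    apply/dual_norm_le1 => y; rewrite modulusM.
    apply: le_trans (fjle i y); rewrite ler_piMl ?modulus_ge0//.
    exact: le_trans (fle _) _.
  - move=> i; apply/dual_norm_le1 => y; rewrite modulusM.
    apply: le_trans (fjle i y); rewrite ler_piMl ?modulus_ge0//.
    exact: le_trans (fle _) _.
  apply: bounded_op_ext => u; rewrite -[RHS]/(dual_fun _ u) dual_fun_sum.
  have := combS (rank_one (bounded_op_linear f) u).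
  rewrite dZ -[X in X * _]/(dual_fun f x) fx mul1r -[LHS]/(f u) => ->.
  by apply: eq_bigr => i _; rewrite dZ.
move=> j wj T; apply: eq_bigr => i _; rewrite ajE//; congr (_ * _).
rewrite -[in RHS](xE j wj) -[in RHS](ffj j wj).
have -> : op_fun (tuple_nth T i) (dual_fun (fj j) x *: xj j) =
  dual_fun (fj j) x *: op_fun (tuple_nth T i) (xj j) by exact: bounded_opZ.
have fjf : dual_fun (fj j) x * dual_fun f (xj j) = 1.
  by rewrite -dZ (xE j wj).
rewrite dZ -[dual_fun (_ *: fj j) _]/(dual_fun f (xj j) * dual_fun (fj j) _).
by rewrite mulrA fjf mul1r.
Qed.

Lemma tensor_extreme (a : 'I_d -> F) (f : Xdual X) (x : X)
  (xf : state_pairs X (x, f)) :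
  lp_norm q a = 1 -> ball_extreme_points (dual_norm (Xnorm X)) f ->
  ball_extreme_points (Xnorm X) x ->
  ball_extreme_points (Zdual_norm X d p) (tensor a xf).
Proof.
move=> a1 fext xext.
have fx : dual_fun f x = 1 by case: ((state_pairsP _ _).1 xf).
split; first by apply: tensor_in_ball; rewrite a1.
move=> psi1 psi2 t ball1 ball2 /andP[t0 t1] psiE.
have [k1 [w1 [a1' [f1 [x1 [w10 w11 a11 xf1 psi1E]]]]]] := Zdual_ball_hull ball1.
have [k2 [w2 [a2' [f2 [x2 [w20 w21 a21 xf2 psi2E]]]]]] := Zdual_ball_hull ball2.
pose w (j : 'I_k1 + 'I_k2) :=
  match j with inl j => t * w1 j | inr j => (1 - t) * w2 j end.
have t1' : 0 < 1 - t by rewrite subr_gt0.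
have H := @extreme_tensor_combination ('I_k1 + 'I_k2)%type w a f x
  (fun j => match j with inl j => a1' j | inr j => a2' j end)
  (fun j => match j with inl j => f1 j | inr j => f2 j end)
  (fun j => match j with inl j => x1 j | inr j => x2 j end) a1 fext xext fx.
have {}H : forall j, 0 < w j -> forall T : Z,
    tensor_functional (match j with inl j => a1' j | inr j => a2' j end)
      (match j with inl j => f1 j | inr j => f2 j end)
      (match j with inl j => x1 j | inr j => x2 j end) T =
    tensor_functional a f x T.
  apply: H.
  - by case=> j; rewrite mulr_ge0// ltW.
  - by rewrite big_sumType/= -!mulr_sumr w11 w21 !mulr1 subrKC.
  - by case.
  - by case.
  - move=> T; rewrite -[LHS]/(Zdual_fun (tensor a xf) T) psiE.
    rewrite [LHS](_ : _ = ofReal t * Zdual_fun psi1 T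
      + ofReal (1 - t) * Zdual_fun psi2 T)// psi1E psi2E big_sumType/=.
    by rewrite !mulr_sumr; congr (_ + _); apply: eq_bigr => j _;
      rewrite ofRealM mulrA.
have one (k : nat) (u : 'I_k -> R) (g : 'I_k -> F) (z : F) :
    (forall j, 0 <= u j) -> \sum_j u j = 1 ->
    (forall j, 0 < u j -> g j = z) -> \sum_j ofReal (u j) * g j = z.
  move=> u0 u1 gz; transitivity (\sum_j ofReal (u j) * z).
    apply: eq_bigr => j _; have [->|uj] := eqVneq (u j) 0.
      by rewrite ofReal0 !mul0r.
    by rewrite gz// lt_neqAle eq_sym uj u0.
  by rewrite -mulr_suml -ofReal_sum u1 ofReal1 mul1r.
split; apply: bounded_op_ext => T.
  rewrite -[LHS]/(Zdual_fun psi1 T) psi1E; apply: one => // j wj.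
  by apply: (H (inl j)); rewrite /= mulr_gt0.
rewrite -[LHS]/(Zdual_fun psi2 T) psi2E; apply: one => // j wj.
by apply: (H (inr j)); rewrite /= mulr_gt0.
Qed.

Lemma extreme_tensor_coefficients (a : 'I_d -> F) (f : Xdual X) (x : X)
  (xf : state_pairs X (x, f)) : (0 < d)%N -> lp_norm q a <= 1 ->
  ball_extreme_points (Zdual_norm X d p) (tensor a xf) -> lp_norm q a = 1.
Proof.
move=> d0 a1 [_ ext]; apply/eqP; rewrite eq_le a1 leNgt; apply/negP => alt1.
have fx : dual_fun f x = 1 by case: ((state_pairsP _ _).1 xf).
(* If the norm r of a were less than 1, then a = r c would lie strictly
   between two distinct points c and - c of the ball. *)
have [c [r [r0 r1 c1 cn0 acE]]] : exists (c : 'I_d -> F) (r : R),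
    [/\ 0 <= r, r < 1, lp_norm q c <= 1, exists i, c i != 0
      & forall i, a i = ofReal r * c i].
  have [a0|/eqP a0] := pselect (lp_norm q a = 0).
    exists (fun i => (i == Ordinal d0)%:R), 0; split.
    - exact: lexx.
    - exact: ltr01.
    - by rewrite lp_norm_single.
    - by exists (Ordinal d0); rewrite eqxx oner_eq0.
    - by move=> i; rewrite ofReal0 mul0r (lp_norm_eq0 _ a0)// gt_eqF.
  have a_gt0 : 0 < lp_norm q a by rewrite lt_neqAle eq_sym a0 lp_norm_ge0.
  have cn := lp_norm_normalize q0 a_gt0.
  exists (fun i => ofReal (lp_norm q a)^-1 * a i), (lp_norm q a); split.
  - exact: ltW.
  - exact: alt1.
  - by rewrite cn.
  - apply: (@lp_norm_neq0 _ _ _ q); first by rewrite gt_eqF.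
    by rewrite cn oner_eq0.
  - by move=> i; rewrite mulrA -ofRealM mulfV// ofReal1 mul1r.
pose t := (1 + r) / 2.
have t01 : 0 < t < 1 by exact: midpoint_bounds.
have cN1 : lp_norm q (fun i => -1 * c i) <= 1.
  by rewrite lp_normZ ?gt_eqF// modulusN modulus1 mul1r.
have [i ci] := cn0.
have [] := ext (tensor c xf) (tensor (fun i => -1 * c i) xf) t _ _ t01 _.
- exact: tensor_in_ball.
- exact: tensor_in_ball.
- apply: bounded_op_ext => T.
  rewrite -[RHS]/(ofReal t * tensor_functional c f x T +
    ofReal (1 - t) * tensor_functional (fun i => -1 * c i) f x T).
  rewrite -[LHS]/(tensor_functional a f x T) /tensor_functional !mulr_sumr.
  rewrite -big_split; apply: eq_bigr => l _; rewrite acE /=.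
  have -> : r = t + - (1 - t) by rewrite /t; field.
  by rewrite ofRealD ofRealN; ring.
move=> /(congr1 (fun h => Zdual_fun h (slot i id_operator))) E1.
move=> /(congr1 (fun h => Zdual_fun h (slot i id_operator))).
rewrite -{}E1.
rewrite -[LHS]/(tensor_functional (fun i => -1 * c i) f x _).
rewrite -[RHS]/(tensor_functional c f x _) !tensor_functional_slot.
rewrite fx !mulr1 mulN1r => cc; move/eqP: ci; apply.
have : ofReal 2 * c i = 0.
  have -> : ofReal 2 = 1 + 1 :> F by rewrite -(ofReal1 R s) -ofRealD.
  by rewrite mulrDl mul1r -{1}cc addNr.
move=> /eqP; rewrite mulf_eq0 => /orP[/eqP|/eqP//].
by rewrite -(ofReal0 R s) => /ofReal_inj/eqP; rewrite pnatr_eq0.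
Qed.

(** Being extreme in the convex hull of K, psi lies in K.  If f is strictly
    between g and h in its unit ball then g(x) = h(x) = 1, so that g and h stay
    in Pi with x and psi decomposes accordingly; likewise for x. *)
Lemma extreme_is_tensor (psi : Zdual X d p) : (0 < d)%N ->
  ball_extreme_points (Zdual_norm X d p) psi ->
  exists (a : 'I_d -> F) (f : Xdual X) (x : X),
  [/\ lp_norm q a = 1, ball_extreme_points (dual_norm (Xnorm X)) f,
      ball_extreme_points (Xnorm X) x, dual_fun f x = 1
    & Zdual_fun psi = tensor_functional a f x].
Proof.
move=> d0 psi_ext.
have [k [w [aj [fj [xj [w0 w1 aj1 xfj psiE]]]]]] := Zdual_ball_hull psi_ext.1.
have [j wj] : exists j, 0 < w j.
  apply: contrapT => /forallNP wN; move/eqP: w1; apply/negP.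
  rewrite big1 ?(eq_sym 0) ?oner_eq0// => j _; apply/eqP.
  by rewrite eq_le w0 andbT leNgt; apply/negP/wN.
have {w0 w1 aj1 psiE wj} [a1 psiE] : lp_norm q (aj j) <= 1 /\
    tensor (aj j) (xfj j) = psi.
  split; first exact: aj1.
  apply: (@extreme_point_combination R s (Zdual X d p)
    (unit_ball (Zdual_norm X d p)) _ w
    (fun j => tensor (aj j) (xfj j)) psi _ _ psi_ext w0 w1 _ j wj).
  - move=> w' w'0 w'1; apply: dual_ball_convex => //.
    + exact: joint_num_radius_ge0.
    + exact: joint_num_radiusZ.
    + by move=> i; exact: tensor_in_ball.
  - by move=> i; exact: tensor_in_ball.
  apply: bounded_op_ext => T; rewrite -[LHS]/(Zdual_fun psi T) psiE.
  by rewrite -[RHS]/(dual_fun _ T) dual_fun_sum.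
move: (aj j) (fj j) (xj j) (xfj j) a1 psiE => a f x xf a1 psiE.
rewrite -{}psiE in psi_ext *.
have a_eq1 := extreme_tensor_coefficients d0 a1 psi_ext.
have [x1 f1 fx] := (state_pairsP _ _).1 xf.
have [i0 ai0] : exists i, a i != 0.
  by apply: (lp_norm_neq0 (p := q)); rewrite ?(gt_eqF q0)// a_eq1 oner_eq0.
have tensor_eq f' x' (xf' : state_pairs X (x', f')) (S : operators X) :
    tensor a xf' = tensor a xf ->
    dual_fun f' (op_fun S x') = dual_fun f (op_fun S x).
  move=> /(congr1 (fun h => Zdual_fun h (slot i0 S))) E; apply: (mulfI ai0).
  by rewrite -!tensor_functional_slot; exact: E.
exists a, f, x; split => //.
- split=> // g h t g1 h1 t01 fE.
  have gh : dual_fun g x = 1 /\ dual_fun h x = 1.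
    apply: (convex_scalar_eq1 t01).
    + exact: le_trans ((dual_norm_le1 _).1 g1 _) x1.
    + exact: le_trans ((dual_norm_le1 _).1 h1 _) x1.
    + by rewrite -fx fE.
  have xg : state_pairs X (x, g) by apply/state_pairsP; case: gh.
  have xh : state_pairs X (x, h) by apply/state_pairsP; case: gh.
  have [] := psi_ext.2 (tensor a xg) (tensor a xh) t _ _ t01 _.
  + exact: tensor_in_ball.
  + exact: tensor_in_ball.
  + apply: bounded_op_ext => T.
    rewrite -[RHS]/(ofReal t * tensor_functional a g x T +
      ofReal (1 - t) * tensor_functional a h x T).
    rewrite -[LHS]/(tensor_functional a f x T) /tensor_functional !mulr_sumr.
    rewrite -big_split; apply: eq_bigr => l _; rewrite fE /=.
    set y := op_fun _ _.
    rewrite -[LHS]/(a l * (ofReal t * dual_fun g y +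
      ofReal (1 - t) * dual_fun h y)).
    by ring.
  move=> gE hE; split; apply: bounded_op_ext => u.
    have := tensor_eq _ _ _ (rank_one (bounded_op_linear f) u) gE.
    by rewrite !rank_one_dual (fx : f x = 1) !mul1r.
  have := tensor_eq _ _ _ (rank_one (bounded_op_linear f) u) hE.
  by rewrite !rank_one_dual (fx : f x = 1) !mul1r.
- split=> // u v t u1 v1 t01 xE.
  have fle y : modulus (dual_fun f y) <= Xnorm X y.
    by exact: (dual_norm_le1 _).1.
  have uv : dual_fun f u = 1 /\ dual_fun f v = 1.
    apply: (convex_scalar_eq1 t01).
    + exact: le_trans (fle _) u1.
    + exact: le_trans (fle _) v1.
    + rewrite -fx xE [RHS]bounded_opD.
      by congr (_ + _); exact/esym/(bounded_opZ f).
  have uf : state_pairs X (u, f) by apply/state_pairsP; case: uv.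
  have vf : state_pairs X (v, f) by apply/state_pairsP; case: uv.
  have [] := psi_ext.2 (tensor a uf) (tensor a vf) t _ _ t01 _.
  + exact: tensor_in_ball.
  + exact: tensor_in_ball.
  + apply: bounded_op_ext => T.
    rewrite -[RHS]/(ofReal t * tensor_functional a f u T +
      ofReal (1 - t) * tensor_functional a f v T).
    rewrite -[LHS]/(tensor_functional a f x T) /tensor_functional !mulr_sumr.
    rewrite -big_split; apply: eq_bigr => l _ /=; rewrite xE.
    set S := tuple_nth T l.
    have -> : dual_fun f (op_fun S (ofReal t *: u + ofReal (1 - t) *: v)) =
        ofReal t * dual_fun f (op_fun S u) +
        ofReal (1 - t) * dual_fun f (op_fun S v).
      rewrite [op_fun S _]bounded_opD !bounded_opZ [LHS]bounded_opD.
      by rewrite !bounded_opZ.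
    by ring.
  move=> uE vE; split; apply: scalar_coordinates_inj => l.
    have := tensor_eq _ _ _ (rank_one (phi_linear l) x) uE.
    by rewrite !rank_one_dual fx !mulr1.
  have := tensor_eq _ _ _ (rank_one (phi_linear l) x) vE.
  by rewrite !rank_one_dual fx !mulr1.
Qed.

End TensorFunctionals.

Unset Implicit Arguments.

Theorem corollary2p7 (R : realType) (s : scalars)
  (X : completeNormedModType (scalarField R s))
  (X_neq0 : exists x : X, x != 0)
  (num_radius_norm : is_norm (num_radius X))
  (d : nat) (d_gt0 : (1 <= d)%N)
  (p q : R) (p_gt1 : 1 < p) (pq : p^-1 + q^-1 = 1)
  (X_finite_dim : finite_dim X)
  (hX : [\/ smooth_space (Xnorm X),
            smooth_space (dual_norm (Xnorm X)),
            polyhedral (Xnorm X)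
          | has_dim X 2]) :
  [set Zdual_fun phi
     | phi in ball_extreme_points (Zdual_norm X d p)]
  = U_set X d q.
Proof.
have [n Xn] := X_finite_dim.
have [m [b [coord [coordK bK]]]] := real_coordinates Xn.
have [e [phi [phi_linear phiE]]] := scalar_coordinates Xn.
have p0 : 0 < p by apply: lt_trans p_gt1.
have q0 : 0 < q.
  by rewrite -invr_gt0 -(addKr p^-1 q^-1) pq addrC subr_gt0 invf_lt1.
(* If Pi were empty the numerical radius would vanish at the identity. *)
have Pi0 : state_pairs X !=set0.
  apply: contrapT => Pi0; have [x /eqP x0] := X_neq0; apply: x0.
  have [w_sep _ _] := num_radius_norm.
  rewrite -[x]/(op_fun (id_operator bK coordK) x).
  rewrite (w_sep (id_operator bK coordK))//.
  rewrite /num_radius (_ : [set _ | _ in _] = set0) ?sup0//.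
  by apply/seteqP; split=> [y [u uP _]|y []]; apply: Pi0; exists u.
apply/seteqP; split=> [_ [psi psi_ext <-]|_ [a [f [x [a1 f_ext x_ext fx ->]]]]].
  have [a [f [x [a1 f_ext x_ext fx ->]]]] := extreme_is_tensor p0 q0 pq Pi0
    bK coordK phi_linear phiE d_gt0 psi_ext.
  by exists a, f, x.
have xf : state_pairs X (x, f).
  by apply/state_pairsP; split=> //; [case: x_ext|case: f_ext].
exists (tensor p0 q0 pq a xf) => //.
exact: (tensor_extreme p0 q0 pq Pi0 bK coordK phi_linear phiE xf a1 f_ext
  x_ext).
Qed.
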